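(* Let $(\theta,c)\mapsto(\theta,\eta_c(\theta))$ be a $C^0$-foliation of $\mathbb A$ into graphs, where $\int_{\mathbb T}\eta_c=c$ for every $c\in\mathbb R$. This foliation is exact symplectically homeomorphic to the standard foliation if and only if there exists a $C^1$ map $u:\mathbb A\to\mathbb R$ such that - $u(0,r)=0$ for all $r\in\mathbb R$; - $\eta_c(\theta)=c+\frac{\partial u}{\partial\theta}(\theta,c)$ for all $(\theta,c)\in\mathbb A$; - for all $c\in\mathbb R$, the map $\theta\mapsto\theta+\frac{\partial u}{\partial c}(\theta,c)$ is a homeomorphism of $\mathbb T$.
   Context: $\mathbb T=\mathbb R/\mathbb Z$, $\mathbb A=\mathbb T\times\mathbb R$ with coordinates $(\theta,r)$. A $C^0$-foliation of $\mathbb A$ into graphs, denoted $(\theta,c)\mapsto(\theta,\eta_c(\theta))$, is the family of graphs of functions $\eta_c\in C^0(\mathbb T,\mathbb R)$, $c\in\mathbb R$, such that $(\theta,c)\mapsto(\theta,\eta_c(\theta))$ is a homeomorphism of $\mathbb A$. The standard foliation is the foliation $\mathcal F_0$ into the circles $\mathbb T\times\{c\}$, $c\in\mathbb R$. A diffeomorphism $g:\mathbb A\to\mathbb A$ is exact symplectic if it is homotopic to the identity and the 1-form $g^*(r\,d\theta)-r\,d\theta$ is exact; an exact symplectic homeomorphism is a homeomorphism that is locally a $C^0$ uniform limit of exact symplectic diffeomorphisms. A foliation $\mathcal F$ is exact symplectically homeomorphic to the standard foliation if there is an exact symplectic homeomorphism $\Phi:\mathbb A\to\mathbb A$ with $\Phi(\mathcal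 F)=\mathcal F_0$. *)

(* Defs.v *)
From HB Require Import structures.
From mathcomp Require Import all_boot all_order all_algebra generic_quotient.
From mathcomp Require Import all_classical all_reals all_analysis.
From mathcomp Require Import ring.

Set Implicit Arguments.
Unset Strict Implicit.
Unset Printing Implicit Defensive.

Import Order.TTheory GRing.Theory Num.Theory.
Import numFieldNormedType.Exports.

Local Open Scope classical_set_scope.
Local Open Scope ring_scope.
Local Open Scope quotient_scope.

Definition integers (R : realType) : zmodClosed R :=
  GRing.ZmodClosed.clone R (@Num.int_num_subdef R) _.

(** The quotient group R/Z, with the quotient distance: [circle_ball a e b]
    says that some representatives of [a] and [b] are at distance [< e]. *)
Definition circle (R : realType) : Type := Quotient.quot (integers R).

HB.instance Definition _ (R : realType) := GRing.Zmodule.on (circle R).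

Definition circ (R : realType) (x : R) : circle R :=
  \pi_(Quotient.quot (integers R)) x.

Section CircleMetric.
Variable R : realType.
Implicit Types (x y : R) (a b c : circle R).

Lemma circ_eqP x y : circ x = circ y <-> x - y \is a Num.int.
Proof.
rewrite -[_ \is a Num.int]/(_ \in integers R) Quotient.idealrBE.
by split=> [h|/eqP//]; apply/eqP.
Qed.

Lemma circ_surj a : exists x, circ x = a.
Proof. by exists (repr (a : Quotient.quot (integers R))); exact: reprK. Qed.

Lemma circD x y : circ (x + y) = circ x + circ y.
Proof. exact: Quotient.pi_add. Qed.

Definition circle_ball a (e : R) b : Prop :=
  exists x y, [/\ circ x = a, circ y = b & `|x - y| < e].

Lemma circle_ball_center a (e : R) : 0 < e -> circle_ball a e a.
Proof.
by move=> e0; have [x xa] := circ_surj a; exists x, x; rewrite subrr normr0.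
Qed.

Lemma circle_ball_sym a b (e : R) : circle_ball a e b -> circle_ball b e a.
Proof. by move=> [x [y [xa yb xy]]]; exists y, x; rewrite distrC. Qed.

Lemma circle_ball_triangle a b c (e1 e2 : R) :
  circle_ball a e1 b -> circle_ball b e2 c -> circle_ball a (e1 + e2) c.
Proof.
move=> [x [y [xa yb xy]]] [y' [z [yb' zc yz]]].
exists x, (z + (y - y')); split => //.
  have /circ_eqP int : circ y = circ y' by rewrite yb.
  by rewrite -zc; apply/circ_eqP; rewrite addrAC subrr add0r.
have -> : x - (z + (y - y')) = (x - y) + (y' - z) by ring.
by rewrite (le_lt_trans (ler_normD _ _))// ltrD.
Qed.

HB.instance Definition _ := hasNbhs.Build (circle R)
  (nbhs_ (entourage_ circle_ball)).

HB.instance Definition _ := Nbhs_isPseudoMetric.Build R (circle R)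
  erefl circle_ball_center circle_ball_sym circle_ball_triangle erefl.

HB.instance Definition _ := isPointed.Build (circle R) 0.

(** The metric topology on [circle R] is the quotient topology. *)
Lemma open_circleP (U : set (circle R)) : open U <-> open (@circ R @^-1` U).
Proof.
split=> [|]; rewrite !openE => oU.
- move=> x Ux; have /nbhs_ballP[e /= e0 eU] := oU _ Ux.
  apply/nbhs_ballP; exists e => //= y xy; apply: eU.
  by exists x, y; split.
- move=> a; have [x <-] := circ_surj a => Ux.
  have /nbhs_ballP[e /= e0 eU] := oU _ Ux.
  apply/nbhs_ballP; exists e => //= b [x' [y' [xx' <- xy]]].
  have -> : circ y' = circ (y' - (x' - x)).
    apply/circ_eqP; rewrite opprB addrCA subrr addr0.
    exact/circ_eqP.
  apply: eU; rewrite /ball /=; suff -> : x - (y' - (x' - x)) = x' - y' by [].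
  by ring.
Qed.

End CircleMetric.

Notation annulus R := (circle R * R)%type.

Definition homeomorphism (S T : topologicalType) (f : S -> T) : Prop :=
  exists g : T -> S, [/\ cancel f g, cancel g f, continuous f & continuous g].

Section Annulus.
Variable R : realType.

(** The universal cover R^2 -> A. *)
Definition covering (p : R * R) : annulus R := (circ p.1, p.2).

Definition dx (F : R * R -> R) (p : R * R) : R :=
  derive1 (fun t : R => F (t, p.2)) p.1.

Definition dy (F : R * R -> R) (p : R * R) : R :=
  derive1 (fun t : R => F (p.1, t)) p.2.

Definition C1_plane (F : R * R -> R) : Prop :=
  [/\ forall p, derivable (fun t : R => F (t, p.2)) p.1 1,
      forall p, derivable (fun t : R => F (p.1, t)) p.2 1,
      continuous (dx F) & continuous (dy F)].

Definition C1_annulus (u : annulus R -> R) : Prop :=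
  C1_plane (fun p => u (covering p)).

(** Translating by [circ t] differentiates on the circle without choosing a
    representative of [p.1]. *)
Definition dtheta (u : annulus R -> R) (p : annulus R) : R :=
  derive1 (fun t : R => u (p.1 + circ t, p.2)) 0.

Definition dr (u : annulus R -> R) (p : annulus R) : R :=
  derive1 (fun t : R => u (p.1, t)) p.2.

(** A map of the annulus is of class C^1 when it has a lift of class C^1 to the
    universal cover. *)
Definition C1_lift (G : R * R -> R * R) (g : annulus R -> annulus R) : Prop :=
  [/\ forall p, covering (G p) = g (covering p),
      C1_plane (fun p => (G p).1) & C1_plane (fun p => (G p).2)].

Definition diffeomorphism (g : annulus R -> annulus R) : Prop :=
  exists h : annulus R -> annulus R,
    [/\ cancel g h, cancel h g, exists G, C1_lift G g & exists H, C1_lift H h].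

Definition homotopic_to_id (g : annulus R -> annulus R) : Prop :=
  exists H : R * annulus R -> annulus R,
    [/\ {within `[0, 1]%classic `*` setT, continuous H},
        forall p, H (0, p) = p & forall p, H (1, p) = g p].

(** A 1-form on the annulus is given by its (1-periodic) coefficients
    [(a p, b p)] in the frame (d theta, d r), at the points [p] of the
    universal cover. *)

Definition exact_form (w : R * R -> R * R) : Prop :=
  exists2 S : annulus R -> R, C1_annulus S &
    forall p, w p = (dtheta S (covering p), dr S (covering p)).

Definition liouville (p : R * R) : R * R := (p.2, 0).

(** The pullback [g^*(r d theta)], for [G] a lift of [g]. *)
Definition pullback_liouville (G : R * R -> R * R) (p : R * R) : R * R :=
  ((G p).2 * dx (fun q => (G q).1) p, (G p).2 * dy (fun q => (G q).1) p).

Definition exact_symplectic_diffeo (g : annulus R -> annulus R) : Prop :=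
  [/\ diffeomorphism g, homotopic_to_id g &
      exists2 G, C1_lift G g &
        exact_form (fun p => pullback_liouville G p - liouville p)].

(** One sequence of diffeomorphisms for all points: the limit is uniform on
    compact sets. *)
Definition exact_symplectic_homeo (Phi : annulus R -> annulus R) : Prop :=
  homeomorphism Phi /\
  exists2 f : nat -> annulus R -> annulus R,
    forall n, exact_symplectic_diffeo (f n) &
    forall p : annulus R, exists2 U, nbhs p U & {uniform U, f @ \oo --> Phi}.

Implicit Type eta : R -> circle R -> R.

Definition C0_foliation eta : Prop :=
  (forall c, continuous (eta c)) /\
  homeomorphism (fun p : annulus R => (p.1, eta p.2 p.1) : annulus R).

Definition leaves eta : set (set (annulus R)) :=
  [set [set p | p.2 = eta c p.1] | c in [set: R]].

Definition standard_foliation : R -> circle R -> R := fun c _ => c.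

Definition exact_symp_homeomorphic_to_standard eta : Prop :=
  exists2 Phi, exact_symplectic_homeo Phi &
    [set Phi @` L | L in leaves eta] = leaves standard_foliation.

Definition circle_integral (f : circle R -> R) : R :=
  (\int[lebesgue_measure]_(x in `[0, 1]%classic) f (circ x))%R.

End Annulus.

(* Main.v *)
Require Import Defs.
From mathcomp Require Import all_boot all_order all_algebra.
From mathcomp Require Import all_classical all_reals all_analysis.
From mathcomp Require Import ring lra.

(** Let [f] be exact symplectic with lift [(Theta, R)]. Since
    [R dTheta - r dtheta] is exact, the Jacobian of [f] is [1], and Green's
    formula shows that [alpha(Theta)], for periodic [alpha], and [chi(R)] are
    independent on the annulus: the integral of their product is
    [int alpha] times the integral of [chi(R)]. If [Phi] is a limit of such maps
    sending the leaf of [eta_c] to a circle, with angle [g(theta, c)] on it,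
    take [chi] supported between the images of two leaves and [alpha] supported
    in the image arc of [[x1, x2]]: the area between two nearby leaves over
    [[x1, x2]] is at least (almost) [c' - c] times the length of the arc. Over
    two complementary arcs these lower bounds add up to the total area
    [c' - c], so both are equalities, and [c |-> int_0^x eta_c] has derivative
    [|g(x, c) - g(0, c)|]. Hence [u(x, c) = int_0^x (eta_c - c)] is [C^1].

    Conversely, [u] defines the homeomorphism
    [(theta, eta_c(theta)) |-> (theta + d_c u, c)]. Damped Steklov averages of
    [u] are functions [S] with [C^1] first derivatives and
    [1 + d_theta d_c S > 0]; such an [S] generates an exact symplectic
    diffeomorphism by the same formula, and these converge locally uniformly. *)

Set Implicit Arguments.
Unset Strict Implicit.
Unset Printing Implicit Defensive.

Import Order.TTheory GRing.Theory Num.Theory numFieldNormedType.Exports.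

Local Open Scope classical_set_scope.
Local Open Scope ring_scope.

(** * Primitives of continuous functions *)

(** A $C^0$ limit forgets derivatives, so area preservation has to be used in a form that involves
    only the values of the approximating map: the integrals of [ch(R) * al(Theta)]. Cutoffs
    supported well inside a region give only a one-sided estimate, and the opposite one is supplied
    by the complementary arc. The argument fixes neither the direction in which [Phi] runs along a
    leaf nor the order in which it stacks the image circles: both cases are carried along, and
    absolute values absorb the sign.

    Everything is merely $C^1$: the lifts, the primitive of the exact form, and $u$. Hence Green's
    formula and the closedness of an exact form are obtained by differentiating line integrals with
    respect to a parameter. In the converse direction the mixed derivative of an average of $u$ is a
    second difference of $u$, which the monotonicity of $\theta+\partial_c u$ controls although $u$
    need not have second derivatives. *)

Section Primitive.
Variable R : realType.
Local Notation mu := (@lebesgue_measure R).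
Implicit Types f g : R -> R.

(** Set integrals over reversed segments vanish, so the difference is the oriented integral from 0
    to [x] for either sign of [x]. *)
Definition prim f (x : R) : R :=
  \int[mu]_(t in `[0, x]) f t - \int[mu]_(t in `[x, 0]) f t.

Lemma is_derive_continuous (F : R -> R) (l x : R) :
  is_derive x 1 F l -> {for x, continuous F}.
Proof.
by case=> /derivable1_diffP /differentiable_continuous.
Qed.

Lemma continuous_integrable f (a b : R) : continuous f ->
  mu.-integrable `[a, b] (EFin \o f).
Proof.
move=> cf; apply: continuous_compact_integrable; first exact: segment_compact.
exact: continuous_subspaceT.
Qed.

(** A single integral from a fixed left end, valid on both sides of 0: the form to which the
    fundamental theorem of calculus applies. *)
Lemma prim_shift f (N x : R) : continuous f -> N <= 0 -> N <= x ->
  prim f x = \int[mu]_(t in `[N, x]) f t - \int[mu]_(t in `[N, 0]) f t.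
Proof.
move=> cf N0 Nx; rewrite /prim.
have int := fun a b => @continuous_integrable f a b cf.
have key a b : N <= a -> a <= b ->
    \int[mu]_(t in `[N, b]) f t - \int[mu]_(t in `[N, a]) f t =
    \int[mu]_(t in `[a, b]) f t.
  move=> Na ab; rewrite (@Rintegral_itvB _ f (BLeft N) (BRight b) a).
  - rewrite Rintegral_itv_obnd_cbnd//.
    by apply: integrableS (int a b) => //; exact: subset_itv_oc_cc.
  - exact: int.
  - by rewrite bnd_simp.
  - by rewrite bnd_simp.
have [x0|x0] := leP 0 x.
  rewrite -(key 0 x)//; suff -> : \int[mu]_(t in `[x, 0]) f t = 0 by rewrite subr0.
  move: x0; rewrite le_eqVlt => /predU1P[<-|x0].
    by rewrite set_itv1 Rintegral_set1.
  by rewrite set_itv_ge ?Rintegral_set0// bnd_simp -ltNge.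
rewrite -(key x 0)// ?(ltW x0)// [X in X - _](_ : _ = 0) ?sub0r ?opprB//.
by rewrite set_itv_ge ?Rintegral_set0// bnd_simp -ltNge.
Qed.

Lemma is_derive_prim f (x : R) : continuous f -> is_derive x 1 (prim f) (f x).
Proof.
move=> cf; pose N := - `|x| - 1.
have Nx : N < x by rewrite /N; have := lerNnormlW (lexx `|x|); lra.
have N0 : N <= 0 by rewrite /N; have := normr_ge0 x; lra.
have xx1 : x < x + 1 by rewrite ltrDl.
have [|d e] := continuous_FTC1 xx1 (@continuous_integrable _ N _ cf) _ (cf x).
  by [].
apply: (@near_eq_is_derive _ _ _
  (fun y => \int[mu]_(t in `[N, y]) f t - \int[mu]_(t in `[N, 0]) f t)).
  near=> y; rewrite (@prim_shift _ N)//; near: y.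
  exact: lt_le_nbhsr.
have dd : is_derive x 1 (fun y => \int[mu]_(t in `[N, y]) f t) (f x).
  by apply: DeriveDef; [exact: d|rewrite -derive1E; exact: e].
by rewrite -(subr0 (f x)); apply: is_deriveB.
Unshelve. all: by end_near. Qed.

Lemma prim_unique f (F : R -> R) (a b : R) : continuous f ->
  (forall x : R, is_derive x 1 F (f x)) -> F b - F a = prim f b - prim f a.
Proof.
move=> cf dF; apply/eqP; rewrite -subr_eq0.
rewrite (_ : _ - _ = (F \- prim f) b - (F \- prim f) a); last by rewrite /=; ring.
rewrite subr_eq0; apply/eqP; apply: is_derive_0_is_cst => x.
by rewrite -(subrr (f x)); apply: is_deriveB; exact: is_derive_prim.
Qed.

Lemma le_of_deriv_ge0 (F dF : R -> R) (a b : R) : a <= b ->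
  (forall x : R, is_derive x 1 F (dF x)) ->
  (forall x, a <= x <= b -> 0 <= dF x) -> F a <= F b.
Proof.
move=> ab dFE dF0.
have [|c] := @MVT_segment R F dF a b ab (fun x _ => dFE x).
  by apply: continuous_subspaceT => x; exact: is_derive_continuous (dFE x).
rewrite in_itv/= => /dF0 c0 E; rewrite -subr_ge0 E mulr_ge0// subr_ge0//.
Qed.

(** Locating [c] by its distance to [a] avoids any assumption on the order of [a] and [b]. *)
Lemma mean_value (F dF : R -> R) (a b : R) :
  (forall x : R, is_derive x 1 F (dF x)) ->
  exists2 c, `|c - a| <= `|b - a| & F b - F a = dF c * (b - a).
Proof.
move=> dFE.
have cF : continuous F by move=> x; exact: is_derive_continuous (dFE x).
have [ab|/ltW ba] := leP a b.
  have [|c] := @MVT_segment R F dF a b ab (fun x _ => dFE x); first exact: continuous_subspaceT.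
  rewrite in_itv/= => /andP[ac cb E]; exists c => //.
  by rewrite !ger0_norm ?subr_ge0// lerD2r.
have [|c] := @MVT_segment R F dF b a ba (fun x _ => dFE x); first exact: continuous_subspaceT.
rewrite in_itv/= => /andP[ac cb E]; exists c.
  by rewrite !ler0_norm ?subr_le0// !opprB lerD2l lerN2.
by rewrite -[LHS]opprB E -mulrN opprB.
Qed.

Definition integ f (a b : R) := prim f b - prim f a.

(** The working tool for the identities below: exhibit a primitive of the integrand, without
    returning to measure theory. *)
Lemma integ_unique f (F : R -> R) (a b : R) : continuous f ->
  (forall x : R, is_derive x 1 F (f x)) -> integ f a b = F b - F a.
Proof. by move=> cf dF; rewrite (@prim_unique f F). Qed.

Lemma integ_Rintegral f (a b : R) : continuous f -> a <= b ->
  \int[mu]_(t in `[a, b]) f t = integ f a b.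
Proof.
move=> cf ab; rewrite /integ.
have H : exists N : R, [/\ N <= 0, N <= a & N <= b].
  exists (Num.min 0 a); rewrite !ge_min !lexx/= ?orbT; split => //.
  by rewrite ab orbT.
case: H => N [N0 Na Nb].
rewrite !(@prim_shift _ N)// opprB addrA subrK.
rewrite (@Rintegral_itvB _ f (BLeft N) (BRight b) a).
- rewrite Rintegral_itv_obnd_cbnd//.
  apply: integrableS (@continuous_integrable f a b cf) => //.
  exact: subset_itv_oc_cc.
- exact: continuous_integrable.
- by rewrite bnd_simp.
- by rewrite bnd_simp.
Qed.

Lemma integ_cat f (a b c : R) : integ f a b + integ f b c = integ f a c.
Proof. by rewrite /integ; ring. Qed.

Lemma le_integ f g (a b : R) : continuous f -> continuous g -> a <= b ->
  (forall x, a <= x <= b -> f x <= g x) -> integ f a b <= integ g a b.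
Proof.
move=> cf cg ab fg.
have -> : integ g a b = integ f a b + ((prim g \- prim f) b - (prim g \- prim f) a).
  by rewrite /integ /=; ring.
rewrite lerDl subr_ge0; apply: (@le_of_deriv_ge0 _ (fun x => g x - f x)) => //.
  by move=> x; apply: is_deriveB; exact: is_derive_prim.
by move=> x /fg; rewrite subr_ge0.
Qed.

Lemma integ_cst (k a b : R) : integ (cst k) a b = k * (b - a).
Proof.
have cc : continuous (cst k : R -> R) by move=> x; exact: cvg_cst.
have d (x : R) : is_derive x 1 (fun y : R => k *: y) (cst k x).
  have -> : cst k x = k *: (1 : R) by rewrite /GRing.scale/= mulr1.
  exact: is_deriveZ.
by rewrite (integ_unique _ _ cc d) -mulrBr.
Qed.

Lemma integD f g (a b : R) : continuous f -> continuous g ->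
  integ (f \+ g) a b = integ f a b + integ g a b.
Proof.
move=> cf cg.
have c : continuous (f \+ g) by move=> x; apply: cvgD; [exact: cf|exact: cg].
have d (x : R) : is_derive x 1 (prim f \+ prim g) ((f \+ g) x).
  by apply: is_deriveD; exact: is_derive_prim.
by rewrite (integ_unique _ _ c d) /integ/=; ring.
Qed.

Lemma integZ f (k a b : R) : continuous f ->
  integ (fun x => k * f x) a b = k * integ f a b.
Proof.
move=> cf.
have c : continuous (fun x => k * f x).
  by move=> x; apply: cvgM; [exact: cvg_cst|exact: cf].
have d (x : R) : is_derive x 1 (fun x => k *: prim f x) (k * f x).
  by apply: is_deriveZ; exact: is_derive_prim.
by rewrite (integ_unique _ _ c d) /integ -mulrBr.
Qed.

Lemma integB f g (a b : R) : continuous f -> continuous g ->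
  integ (f \- g) a b = integ f a b - integ g a b.
Proof.
move=> cf cg.
have c : continuous (f \- g) by move=> x; apply: cvgB; [exact: cf|exact: cg].
have d (x : R) : is_derive x 1 (prim f \- prim g) ((f \- g) x).
  by apply: is_deriveB; exact: is_derive_prim.
by rewrite (integ_unique _ _ c d) /integ/=; ring.
Qed.

Lemma norm_integ_le f (k a b : R) : continuous f -> a <= b ->
  (forall x, a <= x <= b -> `|f x| <= k) -> `|integ f a b| <= k * (b - a).
Proof.
move=> cf ab fk; have cc c : continuous (cst c : R -> R) by move=> x; exact: cvg_cst.
rewrite ler_norml -mulNr -!integ_cst; apply/andP; split.
- by apply: le_integ => // x /fk; rewrite ler_norml => /andP[].
- by apply: le_integ => // x /fk; rewrite ler_norml => /andP[].
Qed.

Lemma integC f (a b : R) : integ f a b = - integ f b a.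
Proof. by rewrite /integ; ring. Qed.

Lemma integ_id f (a : R) : integ f a a = 0.
Proof. by rewrite /integ; ring. Qed.

Lemma is_derive_integ_ub f (a x : R) : continuous f ->
  is_derive x 1 (integ f a) (f x).
Proof.
move=> cf; have h : is_derive x 1 (prim f \- cst (prim f a)) (f x - 0).
  by apply: is_deriveB; exact: is_derive_prim.
by move: h; rewrite subr0.
Qed.

End Primitive.

(* Unification must not unfold integrals down to Lebesgue integration. *)
Global Opaque integ.

(** * Continuity of compound expressions *)

Section Ctn.
Variables (R : realType) (T : topologicalType).
Implicit Types f g : T -> R.

Lemma ctsD f g : continuous f -> continuous g -> continuous (fun t => f t + g t).
Proof. by move=> cf cg t; apply: cvgD; [exact: cf|exact: cg]. Qed.

Lemma ctsB f g : continuous f -> continuous g -> continuous (fun t => f t - g t).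
Proof. by move=> cf cg t; apply: cvgB; [exact: cf|exact: cg]. Qed.

Lemma ctsN f : continuous f -> continuous (fun t => - f t).
Proof. by move=> cf t; apply: cvgN; exact: cf. Qed.

Lemma ctsM f g : continuous f -> continuous g -> continuous (fun t => f t * g t).
Proof. by move=> cf cg t; apply: cvgM; [exact: cf|exact: cg]. Qed.

Lemma cts_norm f : continuous f -> continuous (fun t => `|f t|).
Proof. by move=> cf t; apply: cvg_norm; exact: cf. Qed.

Lemma cts_cst (S : topologicalType) (k : S) : continuous (fun _ : T => k).
Proof. by move=> t; exact: cvg_cst. Qed.

Lemma cts_comp (U V : topologicalType) (F : U -> V) (a : T -> U) :
  continuous F -> continuous a -> continuous (fun t => F (a t)).
Proof. by move=> cF ca t; apply: (@continuous_comp _ _ _ a F); [exact: ca|exact: cF]. Qed.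

Lemma cts_pair (U V : topologicalType) (a : T -> U) (b : T -> V) :
  continuous a -> continuous b -> continuous (fun t => (a t, b t)).
Proof. by move=> ca cb t; apply: cvg_pair; [exact: ca|exact: cb]. Qed.

Lemma cts_comp2 (U V W : topologicalType) (F : U * V -> W) (a : T -> U) (b : T -> V) :
  continuous F -> continuous a -> continuous b -> continuous (fun t => F (a t, b t)).
Proof. by move=> cF ca cb; apply: cts_comp => //; exact: cts_pair. Qed.

Lemma cts_fst (U V : topologicalType) (a : T -> U * V) :
  continuous a -> continuous (fun t => (a t).1).
Proof. by move=> ca; apply: (@cts_comp _ _ fst) => // p; exact: cvg_fst. Qed.

Lemma cts_snd (U V : topologicalType) (a : T -> U * V) :
  continuous a -> continuous (fun t => (a t).2).
Proof. by move=> ca; apply: (@cts_comp _ _ snd) => // p; exact: cvg_snd. Qed.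

Lemma cts_id : continuous (fun t : T => t).
Proof. by move=> t; exact: cvg_id. Qed.

End Ctn.

(** A difference is a sum with an opposite, so its pattern has to be tried before that of sums. *)
Ltac cts := repeat (cbv beta; match goal with
  | H : continuous ?f |- continuous ?f => exact: H
  | |- continuous (fun t => t) => exact: cts_id
  | |- continuous (fun _ => ?k) => exact: cts_cst
  | |- continuous (cst _) => exact: cts_cst
  | |- continuous (fun t => @?f t + - (@?g t)) => apply: (@ctsB _ _ f g)
  | |- continuous (fun t => @?f t + @?g t) => apply: (@ctsD _ _ f g)
  | |- continuous (fun t => - (@?f t)) => apply: (@ctsN _ _ f)
  | |- continuous (fun t => @?f t * @?g t) => apply: (@ctsM _ _ f g)
  | |- continuous (fun t => `|@?f t|) => apply: (@cts_norm _ _ f)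
  | |- continuous (fun t => (@?f t).1) => apply: (@cts_fst _ _ _ f)
  | |- continuous (fun t => (@?f t).2) => apply: (@cts_snd _ _ _ f)
  | |- continuous (fun t => (@?f t, @?g t)) => apply: (@cts_pair _ _ _ f g)
  | H : continuous ?F |- continuous (fun t => ?F (@?f t)) =>
      apply: (@cts_comp _ _ _ F f)
  end).

(** * Integrals depending on a parameter *)

Section Param.
Variable R : realType.

(** Compactness of the segment makes the estimate uniform in [x]. Continuity is asked only on the
    slice over [t0], because the local lifts used later are continuous only on a strip. *)
Lemma tube (T : topologicalType) (F : R * T -> R) (a b e : R) (t0 : T) :
  (forall x, a <= x <= b -> {for (x, t0), continuous F}) -> 0 < e ->
  \forall t \near t0, forall x, a <= x <= b -> `|F (x, t) - F (x, t0)| < e.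
Proof.
move=> cF e0.
pose P t x := `|F (x, t) - F (x, t0)| < e.
have near_cov := (compact_near_coveringP _).1 (@segment_compact R a b).
suff : \near t0, `[a, b]%classic `<=` P t0.
  by apply: filterS => t H x xab; apply: H; rewrite /= in_itv.
apply: near_cov => x; rewrite /= in_itv/= => xab.
have /cvgrPdist_lt/(_ (e / 2)) := cF x xab.
rewrite divr_gt0// => /(_ isT)[[A B]] /= [nA nB] AB.
exists (A, B) => //= -[y t] /= [Ay Bt].
have h1 : `|F (x, t0) - F (y, t)| < e / 2 by apply: (AB (y, t)).
have h2 : `|F (x, t0) - F (y, t0)| < e / 2.
  by apply: (AB (y, t0)); split => //=; exact: nbhs_singleton.
rewrite /P (_ : _ - _ = (F (x, t0) - F (y, t0)) - (F (x, t0) - F (y, t))); last by ring.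
by rewrite (le_lt_trans (ler_normB _ _))// [e]splitr ltrD.
Qed.

Lemma cts_integ (T : topologicalType) (F : R * T -> R) (a b : R) :
  continuous F -> continuous (fun t => integ (fun x => F (x, t)) a b).
Proof.
move=> cF; wlog ab : a b / a <= b.
  move=> H; have [/H//|/ltW /H ba] := leP a b.
  rewrite (_ : (fun _ => _) = (fun t => - integ (fun x => F (x, t)) b a)); first exact: ctsN.
  by apply/funext => t; exact: integC.
move=> t0; apply/cvgrPdist_lt => e e0.
(* The added 1 keeps the denominator positive when [a = b] and makes the final inequality strict. *)
have e'0 : 0 < e / (b - a + 1) by rewrite divr_gt0// ltr_wpDl ?subr_ge0.
near=> t.
have cFt s : continuous (fun x : R => F (x, s)) by cts.
rewrite distrC -integB//.
have : `|integ ((fun x => F (x, t)) \- (fun x => F (x, t0))) a b| <=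
    e / (b - a + 1) * (b - a).
  apply: norm_integ_le => //; first by apply: ctsB.
  move=> x xab /=; apply: ltW; move: x xab; near: t.
  by apply: tube => // x _; exact: cF.
move=> /le_lt_trans; apply.
rewrite mulrAC ltr_pdivrMr ?ltr_wpDl ?subr_ge0//.
by rewrite ltr_pM2l// ltrDl.
Unshelve. all: by end_near. Qed.

(** Rescaling to [[0, 1]] turns a moving endpoint into a parameter of the integrand, and exhibits
    the slope of a primitive as a continuous average. *)
Lemma integ_scale (f : R -> R) (a y : R) : continuous f ->
  integ f a y = (y - a) * integ (fun s => f (a + s * (y - a))) 0 1.
Proof.
move=> cf; have cfy : continuous (fun s : R => f (a + s * (y - a))) by cts.
rewrite -integZ//.
have cg : continuous (fun s : R => (y - a) * f (a + s * (y - a))) by cts.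
have d (s : R) : is_derive s 1 (fun s => integ f a (a + s * (y - a)))
    ((y - a) * f (a + s * (y - a))).
  have d1 : is_derive s 1 (fun s : R => a + s * (y - a)) (y - a).
    have -> : (fun s : R => a + s * (y - a)) = (cst a \+ (fun s => (y - a) *: s)).
      by apply/funext => z /=; rewrite mulrC.
    by apply: is_derive_eq; rewrite add0r /GRing.scale/= mulr1.
  have := @is_derive1_comp _ _ _ s _ _ (is_derive_integ_ub a (a + s * (y - a)) cf) d1.
  by rewrite mulrC.
rewrite (integ_unique _ _ cg d) mul1r mul0r addr0 integ_id subr0; congr integ; ring.
Qed.

Lemma cts_integ_to (T : topologicalType) (F : R * T -> R) (a : R) (y : T -> R) :
  continuous F -> continuous y ->
  continuous (fun t => integ (fun x => F (x, t)) a (y t)).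
Proof.
move=> cF cy; have cFt s : continuous (fun x : R => F (x, s)) by cts.
under eq_fun do rewrite integ_scale//.
apply: ctsM; first by cts.
apply: (@cts_integ _ (fun p => F (a + p.1 * (y p.2 - a), p.2))).
cts.
Qed.

(** In Caratheodory's form: the slope of [F (x, _)] between [s0] and [s] is the average of [dF] over
    that segment, which is jointly continuous in [(x, s)] and can be integrated in [x]. *)
Lemma is_derive_integ (F dF : R * R -> R) (a b s0 : R) :
  continuous F -> continuous dF ->
  (forall x s : R, is_derive s 1 (fun s => F (x, s)) (dF (x, s))) ->
  is_derive s0 1 (fun s => integ (fun x => F (x, s)) a b)
    (integ (fun x => dF (x, s0)) a b).
Proof.
move=> cF cdF dFE; apply/is_derive1_caratheodory.
pose h (p : R * R) := integ (fun t => dF (p.1, s0 + t * (p.2 - s0))) 0 1.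
have ch : continuous h.
  by apply: (@cts_integ _ (fun q => dF (q.2.1, s0 + q.1 * (q.2.2 - s0)))); cts.
have cF' s : continuous (fun x : R => F (x, s)) by cts.
exists (fun s => integ (fun x => h (x, s)) a b); split.
- move=> s; rewrite -[LHS](integB a b (cF' s) (cF' s0)) mulrC -integZ; last by cts.
  congr (integ _ a b); apply/funext => x /=.
  have cdFx : continuous (fun t => dF (x, t)) by cts.
  by rewrite /h /= -[RHS](integ_scale s0 s cdFx) (integ_unique _ _ cdFx (dFE x)).
- by apply: cts_integ.
- congr (integ _ a b); apply/funext => x; rewrite /h /=.
  transitivity (integ (cst (dF (x, s0))) 0 1); last by rewrite integ_cst; ring.
  congr (integ _ 0 1); apply/funext => t; rewrite /=; congr (dF (_, _)); ring.
Qed.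

End Param.

(** * Functions of class C^1 on the plane *)

Section C1.
Variable R : realType.
Implicit Types F G Fx Fy : R * R -> R.

(** The partial derivatives are explicit data, so that compositions and inverses come with formulas
    for theirs. *)
Definition C1p F Fx Fy : Prop :=
  [/\ forall x y : R, is_derive x 1 (fun t => F (t, y)) (Fx (x, y)),
      forall x y : R, is_derive y 1 (fun t => F (x, t)) (Fy (x, y)),
      continuous Fx & continuous Fy].

Lemma C1_planeP F : C1_plane F <-> C1p F (dx F) (dy F).
Proof.
split=> [[dF1 dF2 c1 c2]|[dF1 dF2 c1 c2]]; split.
- move=> x y; apply: DeriveDef; first exact: (dF1 (x, y)).
  by rewrite -derive1E.
- move=> x y; apply: DeriveDef; first exact: (dF2 (x, y)).
  by rewrite -derive1E.
- exact: c1.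
- exact: c2.
- by move=> [x y]; case: (dF1 x y).
- by move=> [x y]; case: (dF2 x y).
- exact: c1.
- exact: c2.
Qed.

Lemma C1p_dx F Fx Fy : C1p F Fx Fy -> dx F = Fx.
Proof.
move=> [dF1 _ _ _]; apply/funext => -[x y]; rewrite /dx derive1E.
by case: (dF1 x y).
Qed.

Lemma C1p_dy F Fx Fy : C1p F Fx Fy -> dy F = Fy.
Proof.
move=> [_ dF2 _ _]; apply/funext => -[x y]; rewrite /dy derive1E.
by case: (dF2 x y).
Qed.

Lemma C1p_plane F Fx Fy : C1p F Fx Fy -> C1_plane F.
Proof. by move=> H; apply/C1_planeP; rewrite (C1p_dx H) (C1p_dy H). Qed.

(** Two-variable slopes: [B] averages [Fy] along the vertical through [p0], and [A] averages [Fx]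
    along the horizontal from there to [p]. The last clause lets [B] be inverted in the implicit
    function theorem. *)
Lemma hadamard F Fx Fy (p0 : R * R) : C1p F Fx Fy ->
  exists A B : R * R -> R,
  [/\ continuous A, continuous B, A p0 = Fx p0 /\ B p0 = Fy p0,
      forall p, F p - F p0 = A p * (p.1 - p0.1) + B p * (p.2 - p0.2) &
      forall d, (forall p, d <= Fy p) -> forall p, d <= B p].
Proof.
case: p0 => x0 y0 [d1 d2 c1 c2].
pose A (p : R * R) := integ (fun s => Fx (x0 + s * (p.1 - x0), p.2)) 0 1.
pose B (p : R * R) := integ (fun s => Fy (x0, y0 + s * (p.2 - y0))) 0 1.
have cA : continuous A.
  by apply: (@cts_integ _ _ (fun q => Fx (x0 + q.1 * (q.2.1 - x0), q.2.2))); cts.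
have cB : continuous B.
  by apply: (@cts_integ _ _ (fun q => Fy (x0, y0 + q.1 * (q.2.2 - y0)))); cts.
exists A, B; split => //.
- split; rewrite /A /B /= subrr.
    transitivity (integ (cst (Fx (x0, y0))) 0 1); last by rewrite integ_cst; ring.
    by congr integ; apply/funext => s; rewrite mulr0 addr0.
  transitivity (integ (cst (Fy (x0, y0))) 0 1); last by rewrite integ_cst; ring.
  by congr integ; apply/funext => s; rewrite mulr0 addr0.
- move=> [x y] /=.
  have c1y : continuous (fun t => Fx (t, y)) by cts.
  have c2x : continuous (fun t => Fy (x0, t)) by cts.
  have E1 : F (x, y) - F (x0, y) = (x - x0) * A (x, y).
    rewrite -(integ_unique _ _ c1y (fun t => d1 t y)); exact: integ_scale.
  have E2 : F (x0, y) - F (x0, y0) = (y - y0) * B (x, y).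
    rewrite -(integ_unique _ _ c2x (d2 x0)); exact: integ_scale.
  by rewrite [A _ * _]mulrC [B _ * _]mulrC -E1 -E2; ring.
- move=> d dF p; have <- : integ (cst d) 0 1 = d by rewrite integ_cst; ring.
  apply: le_integ => [| |//|s _]; [by cts|by cts|exact: dF].
Qed.

Lemma C1p_continuous F Fx Fy : C1p F Fx Fy -> continuous F.
Proof.
move=> H p0; have [A [B [cA cB _ E _]]] := hadamard p0 H.
have c : continuous (fun p => F p0 + (A p * (p.1 - p0.1) + B p * (p.2 - p0.2))).
  by cts.
have -> : F = (fun p => F p0 + (A p * (p.1 - p0.1) + B p * (p.2 - p0.2))).
  by apply/funext => p; rewrite -E; ring.
exact: c.
Qed.

Lemma is_derive_comp2 F Fx Fy (a b : R -> R) (t a' b' : R) :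
  C1p F Fx Fy -> is_derive t 1 a a' -> is_derive t 1 b b' ->
  is_derive t 1 (fun s => F (a s, b s))
    (Fx (a t, b t) * a' + Fy (a t, b t) * b').
Proof.
move=> H da db.
have [A [B [cA cB [EA EB] E _]]] := hadamard (a t, b t) H.
have ca := is_derive_continuous da; have cb := is_derive_continuous db.
move/is_derive1_caratheodory : da => [ga [Ea cga ga_t]].
move/is_derive1_caratheodory : db => [gb [Eb cgb gb_t]].
apply/is_derive1_caratheodory.
have cab : {for t, continuous (fun s => (a s, b s))}.
  exact: (cvg_pair ca cb).
exists (fun s => A (a s, b s) * ga s + B (a s, b s) * gb s); split.
- by move=> z; rewrite E /= Ea Eb; ring.
- apply: cvgD; apply: cvgM => //.
    by apply: (@continuous_comp _ _ _ (fun s => (a s, b s)) A) => //; exact: cA.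
  by apply: (@continuous_comp _ _ _ (fun s => (a s, b s)) B) => //; exact: cB.
- by rewrite EA EB ga_t gb_t.
Qed.

Lemma C1p_comp2 F Fx Fy (a ax ay b bx by_ : R * R -> R) :
  C1p F Fx Fy -> C1p a ax ay -> C1p b bx by_ ->
  C1p (fun p => F (a p, b p))
    (fun p => Fx (a p, b p) * ax p + Fy (a p, b p) * bx p)
    (fun p => Fx (a p, b p) * ay p + Fy (a p, b p) * by_ p).
Proof.
move=> H Ha Hb; have ca := C1p_continuous Ha; have cb := C1p_continuous Hb.
case: (H) (Ha) (Hb) => [_ _ c1 c2] [a1 a2 ca1 ca2] [b1 b2 cb1 cb2].
split; [| |by cts|by cts] => x y.
- exact: (is_derive_comp2 H (a1 x y) (b1 x y)).
- exact: (is_derive_comp2 H (a2 x y) (b2 x y)).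
Qed.

Lemma C1p_eq F Fx Fy F' Fx' Fy' : C1p F Fx Fy ->
  F =1 F' -> Fx =1 Fx' -> Fy =1 Fy' -> C1p F' Fx' Fy'.
Proof. by move=> H /funext <- /funext <- /funext <-. Qed.

Lemma C1p_fst : C1p fst (cst 1) (cst 0).
Proof.
by split; [move=> x y; exact: is_derive_id|move=> x y; exact: is_derive_cst|cts|cts].
Qed.

Lemma C1p_snd : C1p snd (cst 0) (cst 1).
Proof.
by split; [move=> x y; exact: is_derive_cst|move=> x y; exact: is_derive_id|cts|cts].
Qed.

Lemma C1p_cst (k : R) : C1p (cst k) (cst 0) (cst 0).
Proof. by split; [move=> x y; exact: is_derive_cst|move=> x y; exact: is_derive_cst|cts|cts]. Qed.

Lemma C1pD F Fx Fy G Gx Gy : C1p F Fx Fy -> C1p G Gx Gy ->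
  C1p (fun p => F p + G p) (fun p => Fx p + Gx p) (fun p => Fy p + Gy p).
Proof.
move=> [f1 f2 c1 c2] [g1 g2 d1 d2]; split; [| |by cts|by cts] => x y.
- exact: (is_deriveD (f1 x y) (g1 x y)).
- exact: (is_deriveD (f2 x y) (g2 x y)).
Qed.

Lemma C1pB F Fx Fy G Gx Gy : C1p F Fx Fy -> C1p G Gx Gy ->
  C1p (fun p => F p - G p) (fun p => Fx p - Gx p) (fun p => Fy p - Gy p).
Proof.
move=> [f1 f2 c1 c2] [g1 g2 d1 d2]; split; [| |by cts|by cts] => x y.
- exact: (is_deriveB (f1 x y) (g1 x y)).
- exact: (is_deriveB (f2 x y) (g2 x y)).
Qed.

Lemma C1pM F Fx Fy G Gx Gy : C1p F Fx Fy -> C1p G Gx Gy ->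
  C1p (fun p => F p * G p) (fun p => Fx p * G p + F p * Gx p)
    (fun p => Fy p * G p + F p * Gy p).
Proof.
move=> HF HG; have cF := C1p_continuous HF; have cG := C1p_continuous HG.
case: HF HG => [f1 f2 c1 c2] [g1 g2 d1 d2]; split; [| |by cts|by cts] => x y.
- have := is_deriveM (f1 x y) (g1 x y); rewrite /GRing.scale/=.
  by rewrite [G _ * _]mulrC addrC.
- have := is_deriveM (f2 x y) (g2 x y); rewrite /GRing.scale/=.
  by rewrite [G _ * _]mulrC addrC.
Qed.

Definition swap (p : R * R) := (p.2, p.1).

Lemma C1p_swap F Fx Fy : C1p F Fx Fy -> C1p (F \o swap) (Fy \o swap) (Fx \o swap).
Proof.
move=> [f1 f2 c1 c2]; split.
- by move=> x y; exact: f2.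
- by move=> x y; exact: f1.
- by apply: (@cts_comp _ _ _ Fy swap) => //; rewrite /swap; cts.
- by apply: (@cts_comp _ _ _ Fx swap) => //; rewrite /swap; cts.
Qed.

(** By monotonicity, [C (t, z)] is within [e] of [y0] exactly when
    [F (t, y0 - e) < z < F (t, y0 + e)], an open condition on [(t, z)]. *)
Lemma fibre_inverse_continuous (T : topologicalType) (F C : T * R -> R) :
  continuous F -> (forall t y y', y < y' -> F (t, y) < F (t, y')) ->
  (forall t z, F (t, C (t, z)) = z) -> continuous C.
Proof.
move=> cF mF FC [t0 z0]; apply/cvgrPdist_lt => e e0.
have m t : {mono (fun y => F (t, y)) : x y / x <= y} by apply: le_mono => x y; exact: mF.
set y0 := C (t0, z0).
have lo : F (t0, y0 - e) < z0 by rewrite -[ltRHS](FC t0); apply: mF; rewrite gtrBl.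
have hi : z0 < F (t0, y0 + e) by rewrite -[ltLHS](FC t0); apply: mF; rewrite ltrDl.
have c1 : continuous (fun q : T * R => q.2 - F (q.1, y0 - e)) by cts.
have c2 : continuous (fun q : T * R => F (q.1, y0 + e) - q.2) by cts.
have n1 : \forall q \near (t0, z0), 0 < q.2 - F (q.1, y0 - e).
  by apply: (cvgr_gt _ (c1 (t0, z0))); rewrite /= subr_gt0.
have n2 : \forall q \near (t0, z0), 0 < F (q.1, y0 + e) - q.2.
  by apply: (cvgr_gt _ (c2 (t0, z0))); rewrite /= subr_gt0.
near=> q; rewrite distrC ltr_distl.
have h1 : 0 < q.2 - F (q.1, y0 - e) by near: q.
have h2 : 0 < F (q.1, y0 + e) - q.2 by near: q.
rewrite subr_gt0 in h1; rewrite subr_gt0 in h2.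
have mlt y y' : (F (q.1, y) < F (q.1, y')) = (y < y') by rewrite !ltNge m.
by rewrite -mlt -[X in _ && X]mlt [q in C q]surjective_pairing FC h1.
Unshelve. all: by end_near. Qed.

Lemma implicit_function F Fx Fy (d : R) : C1p F Fx Fy -> 0 < d ->
  (forall p, d <= Fy p) ->
  exists C : R * R -> R,
  [/\ forall x z, F (x, C (x, z)) = z, forall x y, C (x, F (x, y)) = y &
      C1p C (fun p => - (Fx (p.1, C p) / Fy (p.1, C p)))
            (fun p => (Fy (p.1, C p))^-1)].
Proof.
move=> H d0 dF; have cF := C1p_continuous H; case: (H) => [f1 f2 c1 c2].
have lower x y y' : y <= y' -> d * (y' - y) <= F (x, y') - F (x, y).
  move=> yy'; have c : continuous (fun t => Fy (x, t)) by cts.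
  rewrite -(integ_unique _ _ c (f2 x)) -integ_cst; apply: le_integ => //; cts.
have mF x y y' : y < y' -> F (x, y) < F (x, y').
  move=> yy'; rewrite -subr_gt0 (lt_le_trans _ (lower _ _ _ (ltW yy')))//.
  by rewrite mulr_gt0// subr_gt0.
have surj x z : exists y, F (x, y) = z.
  (* Growth at rate at least [d] brackets [z] between the values at [- K] and [K]; the uniform bound
     thus makes the inverse global. *)
  pose K := `|z - F (x, 0)| / d.
  have K0 : 0 <= K by rewrite divr_ge0// ltW.
  have dK : d * K = `|z - F (x, 0)| by rewrite /K mulrC divfK// gt_eqF.
  have := lower x _ _ K0; have Kn : - K <= 0 by lra.
  have := lower x _ _ Kn; rewrite subr0 sub0r opprK dK => l1 l2.
  have cFx : {within `[- K, K], continuous (fun y => F (x, y))}.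
    by apply: continuous_subspaceT; cts.
  have KK : - K <= K by lra.
  have := @IVT _ _ _ _ z KK cFx.
  case; last by move=> y _ <-; exists y.
  have := ler_norm (z - F (x, 0)); have := lerNnormlW (lexx `|z - F (x, 0)|).
  move: l1 l2; set n := `|_|; move=> l1 l2 l3 l4.
  by rewrite ge_min le_max; apply/andP; split; apply/orP; [left|right]; lra.
have [C0 C0E] := choice (fun p : R * R => surj p.1 p.2).
have FC x z : F (x, C0 (x, z)) = z by exact: (C0E (x, z)).
have CF x y : C0 (x, F (x, y)) = y.
  have [h|h|//] := ltgtP (C0 (x, F (x, y))) y.
    by have := mF x _ _ h; rewrite FC ltxx.
  by have := mF x _ _ h; rewrite FC ltxx.
have cC : continuous C0 by exact: fibre_inverse_continuous mF FC.
have Fy_neq0 p : Fy p != 0 by rewrite gt_eqF// (lt_le_trans d0).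
have cVF : continuous (fun p => (Fy (p.1, C0 p))^-1).
  move=> p; apply: cvgV; first exact: Fy_neq0.
  have c : continuous (fun p => Fy (p.1, C0 p)) by cts.
  exact: c.
exists C0; split => //; split; [| | by cts|by []] => x z.
- have [A [B [cA cB [EA EB] E dB]]] := hadamard (x, C0 (x, z)) H.
  have B_neq0 p : B p != 0 by rewrite gt_eqF// (lt_le_trans d0)// dB.
  have cVB : continuous (fun p => (B p)^-1).
    by move=> p; apply: cvgV => //; exact: cB.
  apply/is_derive1_caratheodory.
  (* Along a level set the increment of [F] in [hadamard] is 0, so the slope of [C0] is
     [- A / B]. *)
  exists (fun t => - (A (t, C0 (t, z)) * (B (t, C0 (t, z)))^-1)); split.
  + move=> t; have := E (t, C0 (t, z)); rewrite !FC subrr /= => /esym/eqP.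
    rewrite addrC addr_eq0 => /eqP h; apply: (mulfI (B_neq0 (t, C0 (t, z)))).
    by rewrite h; field.
  + have c : continuous (fun t => - (A (t, C0 (t, z)) * (B (t, C0 (t, z)))^-1)).
      apply: ctsN; apply: ctsM; first by cts.
      by apply: (@cts_comp _ _ _ _ (fun t => (t, C0 (t, z))) cVB); cts.
    exact: c.
  + by rewrite EA EB.
- have c : continuous (fun t => F (x, t)) by cts.
  have n1 : {near C0 (x, z), cancel (fun t => F (x, t)) (fun t => C0 (x, t))}.
    by near=> t; exact: CF.
  have n2 : {near C0 (x, z), continuous (fun t => F (x, t))}.
    by near=> t; exact: c.
  have inv := is_derive_inverse n1 n2 (f2 _ _) (Fy_neq0 _).
  by rewrite FC in inv; exact: inv.
Unshelve. all: by end_near. Qed.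

End C1.

(** * The circle and its universal cover *)

Section CircleLifts.
Variable R : realType.

Lemma circ_intP (x y : R) : circ x = circ y <-> exists k : int, x = y + k%:~R.
Proof.
rewrite circ_eqP; split=> [/intrP[k E]|[k ->]].
  by exists k; rewrite -E addrC subrK.
by rewrite addrC addKr intr_int.
Qed.

Lemma circ_addz (x : R) (k : int) : circ (x + k%:~R) = circ x.
Proof. by apply/circ_intP; exists k. Qed.

Lemma circ0 : circ (0 : R) = 0.
Proof. by apply: (@addrI _ (circ (0 : R))); rewrite -circD !addr0. Qed.

Lemma cts_circ : continuous (@circ R).
Proof.
apply/continuousP => U; exact: (open_circleP U).1.
Qed.

End CircleLifts.

Ltac cts_circ_step := match goal with
  | |- continuous (fun t => circ (@?f t)) =>
      apply: (@cts_comp _ _ _ (@circ _) f (@cts_circ _))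
  end.
Ltac ctsc := repeat (progress cts || cts_circ_step).

Section CircleDistance.
Variable R : realType.

Lemma periodicz (V : Type) (F : R -> V) : (forall x, F (x + 1) = F x) ->
  forall x (k : int), F (x + k%:~R) = F x.
Proof.
move=> F1; have Fn x (n : nat) : F (x + n%:R) = F x.
  by elim: n => [|n IH]; rewrite ?addr0// -natr1 addrA F1.
by move=> x [n|n]; [exact: Fn|rewrite NegzE mulrNz -[LHS](Fn _ n.+1) subrK].
Qed.

Lemma quasi_periodicz (b : R -> R) : (forall x, b (x + 1) = b x + 1) ->
  forall x (k : int), b (x + k%:~R) = b x + k%:~R.
Proof.
move=> b1 x k; apply: (@addIr _ (- (x + k%:~R))).
rewrite (@periodicz _ (fun x => b x - x)); first by ring.
by move=> y; rewrite b1; ring.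
Qed.

Lemma rep_subproof (a : circle R) : exists x : R, circ x = a.
Proof. exact: circ_surj. Qed.

Definition rep (a : circle R) : R := projT1 (cid (rep_subproof a)).

Lemma repK : cancel rep (@circ R).
Proof. by move=> a; rewrite /rep; case: cid. Qed.

Lemma rep_circ (V : Type) (F : R -> V) : (forall x, F (x + 1) = F x) ->
  forall x, F (rep (circ x)) = F x.
Proof.
move=> F1 x; have /circ_intP[k ->] := repK (circ x); exact: periodicz.
Qed.

(** Open surjections rather than quotient maps, because they are stable under products and the
    covering of the annulus is a product. *)
Definition open_onto (X Y : topologicalType) (q : X -> Y) :=
  (forall y, exists x, q x = y) /\ forall x U, nbhs x U -> nbhs (q x) (q @` U).

Lemma cts_descend (X Y Z : topologicalType) (q : X -> Y) (f : Y -> Z) :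
  open_onto q -> continuous (fun x => f (q x)) -> continuous f.
Proof.
move=> [qs qo] cf y; have [x <-] := qs y => V /= /(cf x) /= /qo.
by apply: filterS => _ [z ? <-].
Qed.

Lemma open_onto_circ : open_onto (@circ R).
Proof.
split=> [a|x U]; first exact: circ_surj.
move=> /nbhs_ballP[e /= e0 eU]; apply/nbhs_ballP; exists e => //=.
move=> b [x' [y' [xx' <- xy]]]; move/circ_intP: xx' => [k E].
exists (y' - k%:~R); last by rewrite -mulrNz circ_addz.
apply: eU; rewrite /ball/= (_ : _ - _ = x' - y')//; rewrite E; ring.
Qed.

Lemma open_onto_id (X : topologicalType) : open_onto (@id X).
Proof. by split=> [y|x U]; [exists y|rewrite image_id]. Qed.

Lemma open_onto_prod (X Y X' Y' : topologicalType) (q : X -> Y) (q' : X' -> Y') :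
  open_onto q -> open_onto q' -> open_onto (fun p : X * X' => (q p.1, q' p.2)).
Proof.
move=> [s o] [s' o']; split=> [[y y']|[x x'] U].
  by have [x <-] := s y; have [x' <-] := s' y'; exists (x, x').
move=> [[A B] /= [nA nB] AB]; exists (q @` A, q' @` B) => /=.
  by split; [exact: o|exact: o'].
by move=> [_ _] [/= [a Aa <-] [b Bb <-]]; exists (a, b) => //; exact: AB.
Qed.

Lemma open_onto_covering : open_onto (@covering R).
Proof. exact: (open_onto_prod open_onto_circ (@open_onto_id R)). Qed.

Lemma cts_covering : continuous (@covering R).
Proof.
by rewrite /covering; ctsc.
Qed.

Lemma cts_circD : continuous (fun p : circle R * circle R => p.1 + p.2).
Proof.
have oo := open_onto_prod open_onto_circ open_onto_circ.
apply: (@cts_descend _ _ (circle R) _ (fun p : circle R * circle R => p.1 + p.2) oo).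
have c : continuous (fun p : R * R => circ (p.1 + p.2)) by ctsc.
rewrite (_ : (fun _ => _) = (fun p : R * R => circ (p.1 + p.2)))//.
by apply/funext => p; rewrite circD.
Qed.

Definition rnd (x : R) : int := Num.floor (x + 2^-1).

(** Distance to the nearest integer. On a difference of representatives it is the metric of the
    circle, see [circle_ballP]. *)
Definition tdist (x : R) : R := `|x - (rnd x)%:~R|.

Lemma tdist_le_half (x : R) : tdist x <= 2^-1.
Proof.
rewrite /tdist /rnd; have := floor_itv (x + 2^-1); rewrite intrD.
by move: (Num.floor _)%:~R => n; rewrite ler_norml; lra.
Qed.

Lemma norm_intr_lt1 (k : int) : `|k%:~R| < 1 :> R -> k = 0.
Proof.
move=> k1; apply/eqP; apply: contraTT k1 => k0; rewrite -leNgt norm_intr_ge1//.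
by rewrite intr_eq0.
Qed.

Lemma tdist_le (x : R) (k : int) : tdist x <= `|x - k%:~R|.
Proof.
have [->|ne] := eqVneq k (rnd x); first exact: lexx.
apply: le_trans (tdist_le_half x) _; rewrite leNgt; apply/negP => lt.
have : `|(k - rnd x)%:~R| < 1 :> R.
  rewrite intrB (_ : _ - _ = (x - (rnd x)%:~R) - (x - k%:~R)); last by ring.
  apply: le_lt_trans (ler_normB _ _) _.
  by have := tdist_le_half x; rewrite /tdist; lra.
by move/norm_intr_lt1/eqP; rewrite subr_eq0 (negbTE ne).
Qed.

Lemma tdist_lipschitz (x y : R) : tdist x <= tdist y + `|x - y|.
Proof.
apply: le_trans (tdist_le x (rnd y)) _.
rewrite (_ : x - (rnd y)%:~R = (y - (rnd y)%:~R) + (x - y)); last by ring.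
exact: ler_normD.
Qed.

Lemma tdistN (x : R) : tdist (- x) = tdist x.
Proof.
suff H z : tdist (- z) <= tdist z by apply/le_anti; rewrite H -{1}(opprK x) H.
apply: le_trans (tdist_le _ (- rnd z)) _.
by rewrite intrN -opprD normrN.
Qed.

Lemma tdist_addz (x : R) (k : int) : tdist (x + k%:~R) = tdist x.
Proof.
have H y l : tdist (y + l%:~R) <= tdist y.
  apply: le_trans (tdist_le _ (rnd y + l)) _.
  by rewrite intrD (_ : y + l%:~R - _ = y - (rnd y)%:~R)//; ring.
by apply/le_anti; rewrite H -{1}(addrK k%:~R x) -intrN H.
Qed.

Lemma tdist_small (x : R) : `|x| <= 2^-1 -> tdist x = `|x|.
Proof.
move=> x2; apply/eqP; rewrite eq_le; apply/andP; split.
  by have := tdist_le x 0; rewrite subr0.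
have [r0|r0] := eqVneq (rnd x) 0; first by rewrite /tdist r0 subr0.
have := norm_intr_ge1 (intr_int R (rnd x)); rewrite intr_eq0 => /(_ r0) r1.
have := ler_normB (x) (x - (rnd x)%:~R); rewrite opprB addrC subrK /tdist.
by lra.
Qed.

Lemma tdist_ge (x w : R) : w <= x <= 1 - w -> w <= tdist x.
Proof.
move=> /andP[w1 w2]; rewrite /tdist; set k := rnd x.
have [k0|k0] := leP k 0.
  have k0' : k%:~R <= 0 :> R by rewrite -(ler_int R) in k0.
  by rewrite (le_trans _ (ler_norm _))//; lra.
have k1 : 1 <= k%:~R :> R by rewrite -[1]/(1%:~R) ler_int.
by rewrite distrC (le_trans _ (ler_norm _))//; lra.
Qed.

Lemma circ_tdist (x y m : R) : circ x = circ y -> tdist (x - m) = tdist (y - m).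
Proof. by move=> /circ_intP[k ->]; rewrite addrAC tdist_addz. Qed.

Lemma circle_ballP (x y e : R) : circle_ball (circ x) e (circ y) <-> tdist (x - y) < e.
Proof.
split=> [[x' [y' [/circ_intP[k ->] /circ_intP[l ->]]]]|H].
  apply: le_lt_trans; rewrite (le_trans (tdist_le _ (l - k)))//.
  by rewrite intrB (_ : x - y - _ = x + k%:~R - (y + l%:~R))//; ring.
exists x, (y + (rnd (x - y))%:~R); split => //; first exact: circ_addz.
by rewrite opprD addrA.
Qed.

End CircleDistance.

(** * Injective circle maps and their lifts *)

Section CircleHomeo.
Variable R : realType.

(** If [b x = b y], then [x] and [y] differ by an integer, which quasi-periodicity forces to be 0.
    So [b] is injective, hence monotone, and [b 1 = b 0 + 1] decides the direction. *)
Lemma circ_injective_increasing (b : R -> R) : continuous b ->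
  (forall x, b (x + 1) = b x + 1) ->
  (forall x y, circ (b x) = circ (b y) -> circ x = circ y) ->
  forall x y, x < y -> b x < b y.
Proof.
move=> cb b1 ib x y xy.
have inj : injective b.
  move=> s t E; have /circ_intP[k Ek] := ib s t (congr1 _ E).
  move: E; rewrite Ek (quasi_periodicz b1) => /eqP.
  by rewrite -subr_eq0 addrAC subrr add0r => /eqP ->; rewrite addr0.
have := @itv_continuous_inj_le R b `]-oo, +oo[.
move=> /(_ _ (continuous_subspaceT cb) (in2W inj)) H.
rewrite ltNge H ?in_itv// -?ltNge//.
by exists 0, 1; rewrite !in_itv; split => //; rewrite -[1]add0r b1 lerDl.
Qed.

(** Fibrewise injectivity suffices: degree one makes the lifts increasing and onto, their inverse is
    jointly continuous by [fibre_inverse_continuous], and it commutes with integer translations, so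
    it descends. *)
Lemma circle_bundle_homeomorphism (D : annulus R -> R) : continuous D ->
  (forall c, injective (fun th : circle R => th + circ (D (th, c)))) ->
  homeomorphism (fun p : annulus R => (p.1 + circ (D p), p.2) : annulus R).
Proof.
move=> cD inj.
pose b (q : R * R) := q.2 + D (circ q.2, q.1).
have cb : continuous b.
  by rewrite /b; ctsc.
have b1 c x : b (c, x + 1) = b (c, x) + 1.
  by rewrite /b /= -[1]/(1%:~R) circ_addz addrAC.
have circb c x : circ (b (c, x)) = circ x + circ (D (circ x, c)).
  by rewrite /b circD.
have mb c x y : x < y -> b (c, x) < b (c, y).
  have cbc : continuous (fun x => b (c, x)) by cts.
  apply: (circ_injective_increasing cbc (b1 c)) => s t.
  by rewrite !circb; exact: inj.
have surj c y : exists x, b (c, x) = y.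
  have [k ky] : exists k : int, `|y - b (c, 0)| <= k%:~R.
    exists (Num.floor `|y - b (c, 0)| + 1); exact/ltW/floorD1_gt.
  have k0 : 0 <= k%:~R :> R by apply: le_trans ky.
  have KK : - k%:~R <= k%:~R :> R by lra.
  have cb' : {within `[- k%:~R, k%:~R], continuous (fun x => b (c, x))}.
    by apply: continuous_subspaceT; cts.
  have [|x _ <-] := @IVT _ _ _ _ y KK cb'; last by exists x.
  have q := quasi_periodicz (b1 c) 0.
  have := q k; have := q (- k); rewrite !add0r intrN => -> ->.
  move: ky; rewrite ler_norml => /andP[h1 h2].
  by rewrite ge_min le_max; apply/andP; split; apply/orP; [left|right]; lra.
have [B0 B0E] := choice (fun q : R * R => surj q.1 q.2).
have bB c y : b (c, B0 (c, y)) = y by exact: (B0E (c, y)).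
have cB : continuous B0 by exact: fibre_inverse_continuous mb bB.
have binj c x y : b (c, x) = b (c, y) -> x = y.
  by move=> E; have [/(mb c)|/(mb c)|//] := ltgtP x y; rewrite E ltxx.
have B1 c y : B0 (c, y + 1) = B0 (c, y) + 1.
  by apply: (binj c); rewrite b1 !bB.
pose g (p : annulus R) := (circ (B0 (p.2, rep p.1)), p.2).
have gE x c : g (circ x, c) = (circ (B0 (c, x)), c).
  rewrite /g /= (@rep_circ _ _ (fun y => circ (B0 (c, y))))// => y.
  by rewrite B1 -[1]/(1%:~R) circ_addz.
exists g; split.
- move=> [th c] /=; have [x <-] := circ_surj th.
  by rewrite -circb gE; congr (circ _, _); apply: (binj c); rewrite bB.
- move=> [th c]; have [x <-] := circ_surj th.
  by rewrite gE /= -circb bB.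
- apply: (@cts_pair _ _ _ (fun p : annulus R => p.1 + circ (D p)) (fun p => p.2)); last by cts.
  apply: (@cts_comp2 _ _ _ _ _ (fun p => p.1) (fun p => circ (D p)) (@cts_circD R)); first by cts.
  by ctsc.
- apply: cts_descend (@open_onto_covering R) _.
  have -> : (fun p => g (covering p)) = (fun p : R * R => (circ (B0 (p.2, p.1)), p.2)).
    by apply/funext => -[x c]; rewrite /covering gE.
  by ctsc.
Qed.

Lemma fibre_homeomorphism (f : annulus R -> circle R) (c : R) :
  homeomorphism (fun p : annulus R => (f p, p.2) : annulus R) ->
  homeomorphism (fun th => f (th, c)).
Proof.
move=> [g [fg gf cf cg]]; exists (fun th => (g (th, c)).1); split.
- by move=> th; have /= -> := fg (th, c).
- move=> th; have := gf (th, c); case: (g (th, c)) => th' c' /= [<-].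
  by move=> ->.
- have := cts_fst cf => /= h; apply: (cts_comp (F := f) (a := fun th => (th, c))) => //.
  by cts.
- by apply: cts_fst; apply: (cts_comp (F := g) (a := fun th => (th, c))) => //; cts.
Qed.

End CircleHomeo.

(** * Exact maps of the annulus *)

Section Fubini.
Variable R : realType.
Implicit Types F W P : R * R -> R.

Definition dinteg F (a b c d : R) := integ (fun y => integ (fun x => F (x, y)) a b) c d.

Lemma is_derive_uniq (f : R -> R) (x l l' : R) :
  is_derive x 1 f l -> is_derive x 1 f l' -> l = l'.
Proof. by move=> [_ <-] [_ <-]. Qed.

Lemma is_derive_mulr (f : R -> R) (x l k : R) :
  is_derive x 1 f l -> is_derive x 1 (fun t => f t * k) (l * k).
Proof.
move=> d; have -> : (fun t => f t * k) = k \*: f by apply/funext => t; exact: mulrC.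
by rewrite mulrC; exact: is_deriveZ.
Qed.

Lemma is_derive_shiftr (f : R -> R) (x k l : R) :
  is_derive (x + k) 1 f l -> is_derive x 1 (fun t => f (t + k)) l.
Proof.
move=> df; have d : is_derive x 1 (fun t : R => t + k) 1.
  have := is_deriveD (is_derive_id x 1) (is_derive_cst k x 1).
  by rewrite addr0.
by have := @is_derive1_comp R f (fun t => t + k) x l 1 df d; rewrite mulr1.
Qed.

(** As a function of the upper end [d], the right-hand side vanishes at [c] and has the inner
    integral of the left-hand side as derivative. *)
Lemma fubini_continuous F (a b c d : R) : continuous F ->
  dinteg F a b c d = integ (fun x => integ (fun y => F (x, y)) c d) a b.
Proof.
move=> cF; have cFx x : continuous (fun y => F (x, y)) by cts.
pose H (p : R * R) := integ (fun y => F (p.1, y)) c p.2.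
have cH : continuous H.
  by apply: (@cts_integ_to _ _ (fun q => F (q.2.1, q.1)) c (fun p => p.2)); cts.
have d1 (s : R) : is_derive s 1 (fun s => integ (fun x => H (x, s)) a b)
    (integ (fun x => F (x, s)) a b).
  apply: (@is_derive_integ _ H F) => [||x t]; [exact: cH|exact: cF|].
  exact: (is_derive_integ_ub c t (cFx x)).
rewrite /dinteg (integ_unique _ _ _ d1); last first.
  by apply: (@cts_integ _ _ F).
rewrite [X in _ - X](_ : _ = 0) ?subr0// /H /=.
transitivity (integ (cst 0) a b : R); last by rewrite integ_cst mul0r.
by congr integ; apply/funext => x; rewrite /= integ_id.
Qed.

Lemma integ_by_parts (f df g dg : R -> R) (a b : R) :
  continuous df -> continuous dg ->
  (forall x : R, is_derive x 1 f (df x)) -> (forall x : R, is_derive x 1 g (dg x)) ->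
  integ (fun x => f x * dg x) a b =
  f b * g b - f a * g a - integ (fun x => df x * g x) a b.
Proof.
move=> cdf cdg f' g'.
have cf : continuous f by move=> x; exact: is_derive_continuous (f' x).
have cg : continuous g by move=> x; exact: is_derive_continuous (g' x).
have c1 : continuous (fun x => f x * dg x) by cts.
have c2 : continuous (fun x => df x * g x) by cts.
have c3 : continuous (fun x => f x * dg x + df x * g x) by cts.
have d (x : R) : is_derive x 1 (f * g) (f x * dg x + df x * g x).
  by have := is_deriveM (f' x) (g' x); rewrite /GRing.scale/= [g x * _]mulrC.
have := integ_unique a b c3 d; rewrite (integD _ _ c1 c2) => E.
by rewrite -[f b * _]/((f * g) b) -[f a * _]/((f * g) a) -E; ring.
Qed.

(* Writing the line integral as the diagonal value of [int W(x, s) d_x P(x, t)]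
   lets one differentiate it without second derivatives of [P]. *)
Lemma is_derive_line_integral W Wx Wy P Px Py (a b s : R) :
  C1p W Wx Wy -> C1p P Px Py ->
  is_derive s 1 (fun s => integ (fun x => W (x, s) * Px (x, s)) a b)
    (integ (fun x => Wy (x, s) * Px (x, s) - Wx (x, s) * Py (x, s)) a b
      + (W (b, s) * Py (b, s) - W (a, s) * Py (a, s))).
Proof.
move=> HW HP; have cW := C1p_continuous HW; have cP := C1p_continuous HP.
case: (HW) (HP) => [w1 w2 cWx cWy] [p1 p2 cPx cPy].
pose J (p : R * R) := integ (fun x => W (x, p.2) * Px (x, p.1)) a b.
pose Jx (p : R * R) := W (b, p.2) * Py (b, p.1) - W (a, p.2) * Py (a, p.1)
  - integ (fun x => Wx (x, p.2) * Py (x, p.1)) a b.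
pose Jy (p : R * R) := integ (fun x => Wy (x, p.2) * Px (x, p.1)) a b.
have HJ : C1p J Jx Jy; first split.
- move=> t u.
  (* Integration by parts moves the [x]-derivative off [P]; only [P] itself is then differentiated
     in [t]. *)
  have -> : (fun t => J (t, u)) =
      (fun t => (W (b, u) *: P (b, t) - W (a, u) *: P (a, t))
        - integ (fun x => Wx (x, u) * P (x, t)) a b).
    apply/funext => v; rewrite /J /=.
    apply: (@integ_by_parts (fun x => W (x, u)) (fun x => Wx (x, u))
      (fun x => P (x, v)) (fun x => Px (x, v))); by cts.
  have d3 : is_derive t 1 (fun t => integ (fun x => Wx (x, u) * P (x, t)) a b)
      (integ (fun x => Wx (x, u) * Py (x, t)) a b).
    apply: (@is_derive_integ _ (fun q => Wx (q.1, u) * P q)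
      (fun q => Wx (q.1, u) * Py q)) => [||x r]; [by cts|by cts|].
    exact: (is_deriveZ (Wx (x, u)) (p2 x r)).
  exact: (is_deriveB (is_deriveB (is_deriveZ _ (p2 b t)) (is_deriveZ _ (p2 a t))) d3).
- move=> t u; apply: (@is_derive_integ _ (fun q => W q * Px (q.1, t))
    (fun q => Wy q * Px (q.1, t))) => [||x r]; [by cts|by cts|].
  exact: (is_derive_mulr (Px (x, t)) (w2 x r)).
- apply: ctsB; first by cts.
  by apply: (@cts_integ _ _ (fun q => Wx (q.1, q.2.2) * Py (q.1, q.2.1))); cts.
- by apply: (@cts_integ _ _ (fun q => Wy (q.1, q.2.2) * Px (q.1, q.2.1))); cts.
have := is_derive_comp2 HJ (is_derive_id s 1) (is_derive_id s 1).
rewrite !mulr1 /Jx /Jy /=; congr is_derive.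
have c1 : continuous (fun x => Wy (x, s) * Px (x, s)) by cts.
have c2 : continuous (fun x => Wx (x, s) * Py (x, s)) by cts.
by rewrite [in RHS](integB _ _ c1 c2); ring.
Qed.

Lemma integer_valued_constant (f : R -> R) : continuous f ->
  (forall x, exists k : int, f x = k%:~R) -> forall x y, f x = f y.
Proof.
move=> cf fi; suff H x y : x <= y -> f x = f y.
  by move=> x y; have [/H|/ltW/H/esym] := leP x y.
move=> xy; have [k fx] := fi x; have [l fy] := fi y.
rewrite fx fy; have [->//|kl] := eqVneq k l.
have klR : 1 <= `|(k - l)%:~R| :> R.
  by apply: norm_intr_ge1; rewrite ?intr_int// intr_eq0 subr_eq0.
rewrite intrB in klR.
(* A half-integer next to [k] on the side of [l]: the intermediate value theorem would make it a
   value of [f]. *)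
pose v : R := if (k < l)%R then k%:~R + 2^-1 else k%:~R - 2^-1.
have cf' : {within `[x, y], continuous f} by exact: continuous_subspaceT.
have [|z _ E] := @IVT R f x y v xy cf'.
  rewrite fx fy ge_min le_max /v; case: ltP => kl'.
    have {}kl' : k%:~R < l%:~R :> R by rewrite ltr_int.
    rewrite ler0_norm in klR; last by rewrite subr_le0 ltW.
    by apply/andP; split; apply/orP; [left|right]; lra.
  have {}kl' : l%:~R <= k%:~R :> R by rewrite ler_int.
  rewrite ger0_norm in klR; last by rewrite subr_ge0.
  by apply/andP; split; apply/orP; [right|left]; lra.
have [m fz] := fi z; rewrite fz in E.
have h : `|(m - k)%:~R : R| = 2^-1.
  by rewrite intrB E /v; case: ifP => _; rewrite addrAC subrr add0r ?normrN ger0_norm.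
have := @norm_intr_lt1 R (m - k); rewrite h => /(_ _)/eqP; rewrite subr_eq0.
have -> : (2^-1 < 1 :> R) = true by lra.
move=> /(_ isT)/eqP mk; move: h; rewrite mk subrr normr0 => /eqP.
by rewrite eq_sym invr_eq0 pnatr_eq0.
Qed.

Lemma integ_periodic (f : R -> R) (x : R) (k : int) : continuous f ->
  (forall x, f (x + 1) = f x) -> integ f x (x + k%:~R) = k%:~R * integ f 0 1.
Proof.
move=> cf f1.
have I1 y : integ f y (y + 1) = integ f 0 1.
  have d1 (z : R) : is_derive z 1 (fun z => integ f 0 (z + 1) - integ f 0 z) 0.
    have h := is_deriveB (is_derive_shiftr (is_derive_integ_ub 0 (z + 1) cf))
      (is_derive_integ_ub 0 z cf).
    by move: h; rewrite f1 subrr.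
  have := is_derive_0_is_cst y 0 d1; rewrite add0r integ_id subr0 => <-.
  by rewrite -(integ_cat f 0 y (y + 1)); ring.
have In y (n : nat) : integ f y (y + n%:R) = n%:R * integ f 0 1.
  elim: n => [|n IH]; first by rewrite addr0 integ_id mul0r.
  by rewrite -natr1 addrA -(integ_cat _ _ (y + n%:R)) IH I1; ring.
case: k => n; first exact: In.
rewrite NegzE mulrNz integC -{2}(subrK (n.+1)%:R x).
by rewrite In mulNr.
Qed.

End Fubini.

(** * Jacobian and equidistribution of exact maps *)

Section ExactMaps.
Variable R : realType.

Lemma dtheta_covering (u : annulus R -> R) (p : R * R) : C1_annulus u ->
  dtheta u (covering p) = dx (fun q => u (covering q)) p.
Proof.
move=> /C1_planeP [d _ _ _]; case: p => x c.
rewrite /dtheta derive1E.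
have -> : (fun t => u ((covering (x, c)).1 + circ t, (covering (x, c)).2)) =
    (fun t => u (covering (t + x, c))).
  by apply/funext => t; rewrite /covering /= -circD addrC.
have := d (0 + x) c => /(@is_derive_shiftr R (fun t => u (covering (t, c)))) [_ ->].
by rewrite add0r.
Qed.

Variables (g : annulus R -> annulus R) (G : R * R -> R * R).
Hypothesis lift_g : C1_lift G g.

Let Th p := (G p).1.
Let Rr p := (G p).2.

Lemma lift_periodic x y :
  Rr (x + 1, y) = Rr (x, y) /\ exists k : int, Th (x + 1, y) = Th (x, y) + k%:~R.
Proof.
case: lift_g => [cG _ _]; have := cG (x + 1, y); rewrite /covering /= => E1.
have := cG (x, y); rewrite /covering /= -[circ x](circ_addz x 1) -E1 => -[h1 h2].
by split; [rewrite /Rr h2|apply/circ_intP].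
Qed.

(** The primitive [s] is only $C^1$, so mixed derivatives cannot be compared. Instead, the integral
    of [R dTheta] over a horizontal segment is differentiated in [y] in two ways, by
    [is_derive_line_integral] and through [s]. The boundary terms agree, so the Jacobian has
    integral [b - a] over every segment. *)
Lemma exact_det1 :
  exact_form (fun p => pullback_liouville G p - liouville p) ->
  forall p, dy Rr p * dx Th p - dx Rr p * dy Th p = 1.
Proof.
case: lift_g => [cG /C1_planeP HT /C1_planeP HR] [S C1S E].
pose s p := S (covering p).
have HS : C1p s (dx s) (dy s) by apply/C1_planeP.
rewrite -/Th -/Rr in HT HR.
have sx p : Rr p * dx Th p = p.2 + dx s p.
  have := congr1 fst (E p); rewrite /= dtheta_covering// => <-.
  by rewrite /pullback_liouville /liouville /=; ring.
have sy p : Rr p * dy Th p = dy s p.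
  have /= Ep := congr1 snd (E p); rewrite -[RHS]Ep.
  by rewrite /pullback_liouville /liouville /= subr0.
have [t1 t2 ct1 ct2] := HT; have [r1 r2 cr1 cr2] := HR.
have [s1 s2 cs1 cs2] := HS.
pose det p := dy Rr p * dx Th p - dx Rr p * dy Th p.
have cdet : continuous det by rewrite /det; cts.
have idet a b y : integ (fun x => det (x, y)) a b = b - a.
  have H := is_derive_line_integral a b y HR HT.
  have d2 : is_derive y 1 (fun y => (b - a) * y + (s (b, y) - s (a, y)))
      ((b - a) * 1 + (dy s (b, y) - dy s (a, y))).
    exact: (is_deriveD (is_deriveZ (b - a) (is_derive_id y 1)) (is_deriveB (s2 b y) (s2 a y))).
  have E2 : (fun y => integ (fun x => Rr (x, y) * dx Th (x, y)) a b) =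
            (fun y => (b - a) * y + (s (b, y) - s (a, y))).
    apply/funext => z.
    rewrite (_ : (fun x => _) = (cst z \+ (fun x => dx s (x, z)))); last first.
      by apply/funext => x; rewrite sx.
    have c1 : continuous (fun x => dx s (x, z)) by cts.
    have c0 : continuous (cst z : R -> R) by cts.
    by rewrite integD// integ_cst (integ_unique _ _ c1 (fun x => s1 x z)); ring.
  rewrite E2 in H; have := is_derive_uniq H d2.
  by rewrite !sy mulr1 => /addIr.
move=> [x y]; have cd : continuous (fun x => det (x, y)) by cts.
have D := is_derive_integ_ub 0 x cd.
rewrite (_ : integ _ _ = (fun x => x - 0)) in D; last first.
  by apply/funext => z; exact: idet.
have D' := is_deriveB (is_derive_id x 1) (is_derive_cst (0 : R) x 1).
by rewrite -[LHS]/(det (x, y)) (is_derive_uniq D D') subr0.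
Qed.

(** Let [X] and [A] be primitives of [ch] and [al]. The integral of [X(R) d(A(Theta))] over the
    circle at height [s] has as derivative that of [ch(R) al(Theta)], the Jacobian being 1. The
    hypotheses on [c] and [d] say that [X(R)] is constant on the two boundary circles. *)
Lemma exact_equidistribution (al ch : R -> R) (c d : R) :
  exact_form (fun p => pullback_liouville G p - liouville p) ->
  continuous al -> (forall x, al (x + 1) = al x) -> continuous ch ->
  (exists v, forall x, integ ch 0 (Rr (x, c)) = v) ->
  (exists v, forall x, integ ch 0 (Rr (x, d)) = v) ->
  dinteg (fun p => ch (Rr p) * al (Th p)) 0 1 c d =
  integ al 0 1 * dinteg (fun p => ch (Rr p)) 0 1 c d.
Proof.
move=> ex + + cch [vc Ec] [vd Ed].
(* Since [K] does not depend on [al], the choice [al = 1] identifies it. *)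
suff [K HK] : exists K, forall al : R -> R, continuous al -> (forall x, al (x + 1) = al x) ->
    dinteg (fun p => ch (Rr p) * al (Th p)) 0 1 c d = integ al 0 1 * K.
  move=> cal al1; rewrite (HK _ cal al1); congr (_ * _).
  have c1 : continuous (cst 1 : R -> R) by cts.
  have := HK _ c1 (fun _ => erefl).
  rewrite (_ : (fun p => ch (Rr p) * _) = (fun p => ch (Rr p))); last first.
    by apply/funext => p; rewrite /= mulr1.
  by rewrite integ_cst subr0 !mul1r.
have [kc Ekc] := (lift_periodic 0 c).2; have [kd Ekd] := (lift_periodic 0 d).2.
rewrite add0r in Ekc Ekd.
exists (vd * kd%:~R - vc * kc%:~R) => {}al cal al1.
have det1 := exact_det1 ex.
case: lift_g => [cG /C1_planeP HT /C1_planeP HR]; rewrite -/Th -/Rr in HT HR.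
have cT := C1p_continuous HT; have cR := C1p_continuous HR.
have [t1 t2 ct1 ct2] := HT; have [r1 r2 cr1 cr2] := HR.
have comp1 (f : R -> R) F Fx Fy : continuous f -> C1p F Fx Fy ->
    C1p (fun p => integ f 0 (F p)) (fun p => f (F p) * Fx p) (fun p => f (F p) * Fy p).
  move=> cf HF; have cF := C1p_continuous HF; have [f1 f2 cfx cfy] := HF.
  split; [| |by cts|by cts] => x y.
    exact: (is_derive1_comp (is_derive_integ_ub 0 (F (x, y)) cf) (f1 x y)).
  exact: (is_derive1_comp (is_derive_integ_ub 0 (F (x, y)) cf) (f2 x y)).
have HW := comp1 _ _ _ _ cch HR; have HP := comp1 _ _ _ _ cal HT.
pose I s := integ (fun x => integ ch 0 (Rr (x, s)) * (al (Th (x, s)) * dx Th (x, s))) 0 1.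
have dI (s : R) : is_derive s 1 I (integ (fun x => ch (Rr (x, s)) * al (Th (x, s))) 0 1).
  have := is_derive_line_integral 0 1 s HW HP; congr is_derive.
  have [R1 [k T1]] := lift_periodic 0 s; rewrite add0r in R1 T1.
  (* The increment of [Th] over one period is a continuous integer, hence constant in [y], so the
     boundary terms at 0 and 1 cancel. *)
  have tE : dy Th (1, s) = dy Th (0, s).
    have kconst y : Th (1, y) = Th (0, y) + k%:~R.
      rewrite -[LHS](subrK (Th (0, y))) addrC; congr (_ + _).
      rewrite (@integer_valued_constant R (fun y => Th (1, y) - Th (0, y)) _ _ y s).
      - by rewrite T1; ring.
      - by cts.
      - move=> z; have [_ [l]] := lift_periodic 0 z; rewrite add0r => ->.
        by exists l; ring.
    have := is_deriveD (t2 0 s) (is_derive_cst (k%:~R : R) s 1).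
    rewrite (_ : _ + cst _ = fun y => Th (1, y)); last first.
      by apply/funext => y; rewrite kconst.
    by move=> /(is_derive_uniq (t2 1 s)); rewrite addr0.
  rewrite R1 tE T1 (periodicz al1) subrr addr0.
  congr integ; apply/funext => x.
  rewrite -[RHS]mulr1 -(det1 (x, s)); ring.
have cI : continuous (fun s => integ (fun x => ch (Rr (x, s)) * al (Th (x, s))) 0 1).
  by apply: (@cts_integ _ _ (fun p => ch (Rr p) * al (Th p))); cts.
rewrite /dinteg (integ_unique _ _ cI dI).
(* On a boundary circle the constant [v] factors out, leaving the integral of [al] over [k]
   turns. *)
have IE s v (k : int) : (forall x, integ ch 0 (Rr (x, s)) = v) ->
    Th (1, s) = Th (0, s) + k%:~R -> I s = v * k%:~R * integ al 0 1.
  move=> Ev Ek; rewrite /I; under eq_fun do rewrite Ev.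
  have c1 : continuous (fun x => al (Th (x, s)) * dx Th (x, s)) by cts.
  have [d1 _ _ _] := HP.
  rewrite integZ// (integ_unique _ _ c1 (fun x => d1 x s)) -mulrA.
  rewrite -(integ_periodic (Th (0, s)) k cal al1) -Ek.
  by rewrite -(integ_cat al 0 (Th (0, s)) (Th (1, s))); ring.
rewrite (IE _ _ _ Ed Ekd) (IE _ _ _ Ec Ekc); ring.
Qed.

End ExactMaps.

(** * From a straightening to a generating function *)

Section Trapezoid.
Variable R : realType.

(** The quotient [(w - z) / d] clamped to [[0, 1]]: 1 up to [w - d], 0 from [w] on. With absolute
    values, continuity is immediate. *)
Definition trap (w d z : R) : R :=
  (`|(w - z) / d| - `|(w - z) / d - 1| + 1) / 2.

Lemma trap_itv w d z : 0 <= trap w d z <= 1.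
Proof.
rewrite /trap; set y := _ / d.
have := ler_normD (y - 1) 1; have := ler_normB y 1; rewrite subrK normr1.
have := ler_normD y (- 1); have := ler_normB 1 y; rewrite normrN normr1.
have := ler_normD (y - 1) (- y); rewrite normrN (_ : y - 1 - y = - 1); last by ring.
by rewrite normrN normr1; lra.
Qed.

Lemma trap0 w d z : 0 < d -> w <= z -> trap w d z = 0.
Proof.
move=> d0 wz; rewrite /trap; set y := _ / d.
have y0 : y <= 0 by rewrite /y mulr_le0_ge0 ?invr_ge0 ?subr_le0// ltW.
by rewrite !ler0_norm//; lra.
Qed.

Lemma trap1 w d z : 0 < d -> z <= w - d -> trap w d z = 1.
Proof.
move=> d0 wz; rewrite /trap; set y := _ / d.
have y0 : 1 <= y by rewrite /y ler_pdivlMr// mul1r; lra.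
by rewrite !ger0_norm//; lra.
Qed.

Lemma cts_trap (T : topologicalType) (w d : R) (f : T -> R) : continuous f ->
  continuous (fun t => trap w d (f t)).
Proof. by move=> cf; rewrite /trap; cts. Qed.

Lemma cts_tdist : continuous (@tdist R).
Proof.
move=> x; apply/cvgrPdist_lt => e e0; near=> y.
apply: (@le_lt_trans _ _ `|x - y|); last by near: y; exact: cvgr_dist_lt.
have h1 := tdist_lipschitz x y; have h2 := tdist_lipschitz y x.
by rewrite distrC in h2; rewrite ler_norml; lra.
Unshelve. all: by end_near. Qed.

Lemma integ_le_sub (f g : R -> R) (a b p q : R) : continuous f -> continuous g ->
  a <= p -> p <= q -> q <= b ->
  (forall x, a <= x <= p -> f x <= 0) -> (forall x, q <= x <= b -> f x <= 0) ->
  (forall x, p <= x <= q -> f x <= g x) -> integ f a b <= integ g p q.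
Proof.
move=> cf cg ap pq qb f1 f2 fg; rewrite -(integ_cat f a p b) -(integ_cat f p q b).
have c0 : continuous (cst 0 : R -> R) by cts.
have := le_integ cf c0 ap f1; have := le_integ cf c0 qb f2.
have := le_integ cf cg pq fg; rewrite !integ_cst !mul0r; lra.
Qed.

Lemma integ_ge_sub (f g : R -> R) (a b p q : R) : continuous f -> continuous g ->
  a <= p -> p <= q -> q <= b -> (forall x, a <= x <= b -> 0 <= f x) ->
  (forall x, p <= x <= q -> g x <= f x) -> integ g p q <= integ f a b.
Proof.
move=> cf cg ap pq qb f0 fg; rewrite -(integ_cat f a p b) -(integ_cat f p q b).
have c0 : continuous (cst 0 : R -> R) by cts.
have h1 : integ (cst 0) a p <= integ f a p.
  by apply: le_integ => // x /andP[? ?]; apply: f0; apply/andP; split; lra.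
have h2 : integ (cst 0) q b <= integ f q b.
  by apply: le_integ => // x /andP[? ?]; apply: f0; apply/andP; split; lra.
have := le_integ cg cf pq fg; move: h1 h2; rewrite !integ_cst !mul0r; lra.
Qed.

Lemma circ_unit (th : circle R) : exists2 x, 0 <= x < 1 & circ x = th.
Proof.
have [x <-] := circ_surj th; exists (x - (Num.floor x)%:~R).
  have := floor_itv x; rewrite intrD; move: (Num.floor x)%:~R => n.
  by move=> /andP[? ?]; apply/andP; split; lra.
by rewrite -mulrNz circ_addz.
Qed.

Lemma integ_tdist_trap (w d m : R) : 0 < d -> 0 <= w -> w + d <= 2^-1 ->
  2 * w <= integ (fun x => trap (w + d) d (tdist (x - m))) 0 1.
Proof.
move=> d0 w0 w2; set f := fun x => _.
have cf : continuous f.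
  apply: cts_trap; apply: (cts_comp (F := @tdist R) (a := fun x => x - m)); last by cts.
  exact: cts_tdist.
have f1 x : f (x + 1) = f x by rewrite /f addrAC -[1]/(1%:~R) tdist_addz.
(* The period is recentred at [m], where the plateau of the bump does not wrap around and [tdist] is
   an absolute value. *)
have := integ_periodic (m - 2^-1) 1 cf f1; rewrite mul1r => <-.
have -> : 2 * w = integ (cst 1) (m - w) (m + w) by rewrite integ_cst; ring.
apply: integ_ge_sub => //; [by cts|lra|lra| |move=> x _|move=> x xm].
- by rewrite -[_%:~R]/1; lra.
- by have /andP[] := trap_itv (w + d) d (tdist (x - m)).
- rewrite /f trap1//; have xw : `|x - m| <= w by rewrite ler_norml; lra.
  by rewrite tdist_small//; lra.
Qed.

(** A window of heights between the images of the leaves [c1] and [c2]. The margin [3 * k] pays for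
    the approximation error at the outer leaves, the ramp of the cutoff, and the error at the inner
    leaves. *)
Lemma level_window (h : R -> R) (c1 c1' c2' c2 : R) :
  c1 < c1' -> c1' < c2' -> c2' < c2 ->
  (forall x y, x < y -> h x < h y) \/ (forall x y, x < y -> h y < h x) ->
  exists mid wid k, [/\ 0 < k,
    (forall c, c <= c1 -> h c <= mid - wid) /\ (forall c, c2 <= c -> mid + wid <= h c) \/
    (forall c, c <= c1 -> mid + wid <= h c) /\ (forall c, c2 <= c -> h c <= mid - wid) &
    forall c, c1' <= c <= c2' -> `|h c - mid| <= wid - 3 * k].
Proof.
move=> l1 l2 l3.
have inc (f : R -> R) : (forall x y, x < y -> f x < f y) ->
  exists mid wid k, [/\ 0 < k, forall c, c <= c1 -> f c <= mid - wid,
    forall c, c2 <= c -> mid + wid <= f c &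
    forall c, c1' <= c <= c2' -> `|f c - mid| <= wid - 3 * k].
  move=> mf; have mle : {homo f : x y / x <= y} by apply: ltW_homo => x y /mf.
  exists ((f c1 + f c2) / 2), ((f c2 - f c1) / 2).
  exists (Num.min (f c1' - f c1) (f c2 - f c2') / 3).
  have := mf _ _ l1; have := mf _ _ l3 => h3 h1.
  split.
  - by rewrite divr_gt0// lt_min !subr_gt0 h1.
  - by move=> c /mle; lra.
  - by move=> c /mle; lra.
  - move=> c /andP[/mle ? /mle ?].
    have : Num.min (f c1' - f c1) (f c2 - f c2') <= f c1' - f c1 by rewrite ge_min lexx.
    have : Num.min (f c1' - f c1) (f c2 - f c2') <= f c2 - f c2' by rewrite ge_min lexx orbT.
    by set mn := Num.min _ _ => ? ?; rewrite ler_norml; lra.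
case=> [/inc|mf].
  by move=> [mid [wid [k [k0 a b c]]]]; exists mid, wid, k; split => //; left.
have [|mid [wid [k [k0 a b c]]]] := inc (fun c => - h c).
  by move=> x y /mf; rewrite ltrN2.
exists (- mid), wid, k; split => //.
  by right; split => z /[dup] ? ; [move/a|move/b]; lra.
by move=> z /c; rewrite opprK -opprD normrN.
Qed.

End Trapezoid.

(** * Injective parametrizations of the circle *)

Section CircleArcs.
Variable R : realType.

Lemma is_derive_eps (f : R -> R) (x l : R) :
  (forall e : R, 0 < e -> \forall y \near x, `|f y - f x - l * (y - x)| <= e * `|y - x|) ->
  is_derive x 1 f l.
Proof.
move=> H; apply/is_derive1_caratheodory.
exists (fun y => if y == x then l else (f y - f x) / (y - x)); split.
- move=> y; case: eqVneq => [->|yx]; first by rewrite !subrr mulr0.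
  by rewrite divfK// subr_eq0.
- apply/cvgrPdist_le => e e0; apply: filterS (H e e0) => y Hy; rewrite eqxx.
  case: eqVneq => [_|yx]; first by rewrite subrr normr0 ltW.
  have yx0 : 0 < `|y - x| by rewrite normr_gt0 subr_eq0.
  rewrite (_ : l - _ = - ((f y - f x - l * (y - x)) / (y - x))).
    by rewrite normrN normrM normfV ler_pdivrMr.
  by field; rewrite subr_eq0.
- by rewrite eqxx.
Qed.

Lemma circ_unit_eq (x y : R) : 0 <= x <= 1 -> 0 <= y <= 1 -> circ x = circ y ->
  [\/ x = y, x = 0 /\ y = 1 | x = 1 /\ y = 0].
Proof.
move=> x01 y01 /circ_intP[k E].
have [k0|k0] := eqVneq k 0; first by constructor 1; rewrite E k0 addr0.
have := norm_intr_ge1 (intr_int R k); rewrite intr_eq0 => /(_ k0).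
have -> : k%:~R = x - y by rewrite E; ring.
by rewrite ler_normr => /orP[]h; [constructor 3|constructor 2]; split; lra.
Qed.

Lemma near_dist (T : topologicalType) (f : T -> R) (t : T) (d : R) :
  {for t, continuous f} -> 0 < d -> \forall s \near t, `|f t - f s| < d.
Proof. by move=> /cvgrPdist_lt cf /cf. Qed.

Lemma near_fst (x c d : R) : 0 < d -> \forall p \near (x, c), `|x - p.1| < d.
Proof.
move=> d0; have c1 : continuous (fun p : R * R => p.1) by cts.
by have /cvgrPdist_lt/(_ _ d0) := c1 (x, c).
Qed.

Lemma near_snd (x c d : R) : 0 < d -> \forall p \near (x, c), `|c - p.2| < d.
Proof.
move=> d0; have c2 : continuous (fun p : R * R => p.2) by cts.
by have /cvgrPdist_lt/(_ _ d0) := c2 (x, c).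
Qed.

(** The lift of a parametrization of the circle by exactly one positive turn, considered on [[0, 1]]
    only. *)
Definition arc_param (f : R -> R) :=
  (forall x y, 0 <= x -> x < y -> y <= 1 -> f x < f y) /\ f 1 = f 0 + 1.

Lemma circ_injective_arc_param (f : R -> R) :
  (forall x, 0 <= x <= 1 -> {for x, continuous f}) ->
  (forall x y, 0 <= x <= 1 -> 0 <= y <= 1 -> circ (f x) = circ (f y) -> circ x = circ y) ->
  circ (f 0) = circ (f 1) ->
  arc_param f \/ arc_param (fun x => - f x).
Proof.
move=> cf0 fi.
have cf (g : R -> R) a b : (forall x, 0 <= x <= 1 -> {for x, continuous g}) ->
    0 <= a -> b <= 1 -> {within `[a, b], continuous g}.
  move=> cg a0 b1; apply: continuous_in_subspaceT => x; rewrite inE/= in_itv/= => xab.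
  by apply: cg; lra.
have fi' x y : 0 <= x <= 1 -> 0 <= y <= 1 -> f x = f y ->
    [\/ x = y, x = 0 /\ y = 1 | x = 1 /\ y = 0].
  by move=> x01 y01 E; apply: circ_unit_eq => //; apply: fi => //; rewrite E.
have f0n1 : f 0 != f 1.
  (* If [f] returned to its initial value, [v] would be attained both before and after [2^-1]. *)
  apply/eqP => E; pose v := (f 0 + f 2^-1) / 2.
  have c1 := cf f 0 2^-1 cf0 (lexx _) ltac:(lra).
  have c2 := cf f 2^-1 1 cf0 ltac:(lra) (lexx _).
  have h01 : 0 <= 2^-1 :> R by lra.
  have h12 : 2^-1 <= 1 :> R by lra.
  have vin a b : (f a = f 0 /\ f b = f 2^-1) \/ (f a = f 2^-1 /\ f b = f 0) ->
      Num.min (f a) (f b) <= v <= Num.max (f a) (f b).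
    rewrite /v ge_min le_max; have [h|h] := leP (f 0) (f 2^-1);
      by case=> -[-> ->]; apply/andP; split; apply/orP; first [left; lra|right; lra].
  have [|y y01 Ey] := @IVT _ _ _ _ v h01 c1; first by apply: vin; left.
  have [|z z01 Ez] := @IVT _ _ _ _ v h12 c2; first by apply: vin; right.
  rewrite !in_itv/= in y01 z01.
  have ne : f 2^-1 != f 0.
    by apply/eqP => E'; have [||?|[? ?]|[? ?]] := fi' _ _ _ _ E'; lra.
  have v0 : v != f 0 by apply: contra_neq ne; rewrite /v; lra.
  have vh : v != f 2^-1 by apply: contra_neq ne; rewrite /v; lra.
  have [||yz|[y0 _]|[y1 _]] := fi' y z _ _ (etrans Ey (esym Ez)); [lra|lra| | |].
  - by move: vh; rewrite -Ey (_ : y = 2^-1) ?eqxx//; lra.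
  - by move: v0; rewrite -Ey y0 eqxx.
  - by move: v0; rewrite -Ey y1 E eqxx.
have inj : {in `[0, 1] &, injective f}.
  move=> x y; rewrite !in_itv/= => x01 y01 E.
  have [//|[x0 y1]|[x1 y0]] := fi' x y x01 y01 E.
    by move: f0n1; rewrite -x0 -y1 E eqxx.
  by move: f0n1; rewrite -x1 -y0 E eqxx.
have inc (g : R -> R) : (forall x, 0 <= x <= 1 -> {for x, continuous g}) ->
    (forall x y, 0 <= x <= 1 -> 0 <= y <= 1 -> circ (g x) = circ (g y) -> circ x = circ y) ->
    (exists k : int, g 1 = g 0 + k%:~R) ->
    (forall x y, 0 <= x -> x < y -> y <= 1 -> g x < g y) ->
    arc_param g.
  move=> cg gi [k Ek] mg; split => //.
  have lt01 := mg 0 1 (lexx _) ltr01 (lexx _).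
  have k1 : 1 <= k%:~R :> R.
    rewrite -[1]/(1%:~R) ler_int -gtz0_ge1 -(ltr_int R); lra.
  (* With more than one turn, [g 0 + 1] would already be reached in the interior, against
     injectivity on the circle. *)
  have [|x x01 Ex] := @IVT _ _ _ _ (g 0 + 1) ler01 (cf g 0 1 cg (lexx _) (lexx _)).
    by rewrite ge_min le_max; apply/andP; split; apply/orP; [left|right]; lra.
  rewrite in_itv/= in x01.
  have z01 : 0 <= (0 : R) <= 1 by lra.
  have cx0 : circ x = circ 0.
    by apply: gi => //; rewrite Ex -[1]/(1%:~R) circ_addz.
  have [x0|[x0 _]|[x1 _]] := circ_unit_eq x01 z01 cx0.
  - by move: Ex => /eqP; rewrite x0 -subr_eq0 opprD addrA subrr sub0r oppr_eq0 oner_eq0.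
  - by move: Ex => /eqP; rewrite x0 -subr_eq0 opprD addrA subrr sub0r oppr_eq0 oner_eq0.
  - by rewrite -Ex x1.
move=> /esym/circ_intP f01.
have [mi|md] := itv_continuous_inj_mono (cf f 0 1 cf0 (lexx _) (lexx _)) inj.
  left; apply: inc => // x y x0 xy y1; apply: mi => //; rewrite in_itv/=; lra.
right; apply: inc => [x x01|x y x01 y01||x y x0 xy y1].
- by apply: cvgN; exact: cf0.
- move=> /circ_intP[k E]; apply: fi => //; apply/circ_intP.
  by exists (- k); rewrite intrN; lra.
- by case: f01 => k E; exists (- k); rewrite intrN; lra.
- rewrite ltrN2; apply: md => //; rewrite in_itv/=; lra.
Qed.

(** Outside an arc, the distance to its midpoint is at least half its length. The degenerate ranges
    [0 <= t <= 0] and [1 <= t <= 1] give both complements the shape required by [area_bound], for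
    the arcs over [[0, x]] and [[x, 1]]. *)
Lemma arc_tdist (f : R -> R) (x : R) : arc_param f \/ arc_param (fun x => - f x) ->
  0 <= x <= 1 -> let L := `|f x - f 0| in
  [/\ 0 <= L <= 1,
   forall t, 0 <= t <= 0 \/ x <= t <= 1 -> L / 2 <= tdist (f t - (f 0 + f x) / 2) &
   forall t, 0 <= t <= x \/ 1 <= t <= 1 -> (1 - L) / 2 <= tdist (f t - (f x + f 1) / 2)].
Proof.
have main (g : R -> R) : arc_param g -> 0 <= x <= 1 -> let L := `|g x - g 0| in
    [/\ 0 <= L <= 1,
     forall t, 0 <= t <= 0 \/ x <= t <= 1 -> L / 2 <= tdist (g t - (g 0 + g x) / 2) &
     forall t, 0 <= t <= x \/ 1 <= t <= 1 -> (1 - L) / 2 <= tdist (g t - (g x + g 1) / 2)].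
  move=> [mg g1] x01 /=.
  have mle s t : 0 <= s -> s <= t -> t <= 1 -> g s <= g t.
    by move=> s0; rewrite le_eqVlt => /predU1P[->//|st t1]; exact/ltW/mg.
  have h0 : g 0 <= g x by apply: mle; lra.
  have h1 : g x <= g 1 by apply: mle; lra.
  rewrite ger0_norm ?subr_ge0//; split; first lra.
  - move=> t [t0|xt].
      have -> : t = 0 by lra.
      by rewrite -tdistN; apply: tdist_ge; lra.
    have a1 : g x <= g t by apply: mle; lra.
    have a2 : g t <= g 1 by apply: mle; lra.
    by apply: tdist_ge; lra.
  - move=> t [t0|xt].
      have a1 : g 0 <= g t by apply: mle; lra.
      have a2 : g t <= g x by apply: mle; lra.
      by rewrite -tdistN; apply: tdist_ge; lra.
    have -> : t = 1 by lra.
    by apply: tdist_ge; lra.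
case=> [/main//|/main H] /H /= [].
have -> : `|- f x - - f 0| = `|f x - f 0| by rewrite -opprD normrN.
move=> L01 h1 h2; split => // t tt.
  have -> : f t - (f 0 + f x) / 2 = - (- f t - (- f 0 - f x) / 2) by ring.
  by rewrite tdistN; exact: h1.
have -> : f t - (f x + f 1) / 2 = - (- f t - (- f x - f 1) / 2) by ring.
by rewrite tdistN; exact: h2.
Qed.

End CircleArcs.

(** * Area estimates and regularity of the generating function *)

Section GeneratingFunction.
Variables (R : realType) (eta : R -> circle R -> R) (h : R -> R).
Variable Phi : annulus R -> annulus R.
Hypothesis eta_cts : continuous (fun p : R * R => eta p.2 (circ p.1)).
Hypothesis eta_int : forall c, integ (fun x => eta c (circ x)) 0 1 = c.
Hypothesis eta_incr : forall c c' th, c < c' -> eta c th < eta c' th.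
Hypothesis eta_surj : forall th r, exists c, eta c th = r.
Hypothesis h_level : forall c th, (Phi (th, eta c th)).2 = h c.
Hypothesis h_mono :
  (forall x y, x < y -> h x < h y) \/ (forall x y, x < y -> h y < h x).
Hypothesis exact_approx : forall M e : R, 0 < e -> exists g G,
  [/\ C1_lift G g, exact_form (fun p => pullback_liouville G p - liouville p) &
  forall x r, `|x| <= M -> `|r| <= M ->
    circle_ball (Phi (circ x, r)).1 e (circ (G (x, r)).1) /\
    `|(Phi (circ x, r)).2 - (G (x, r)).2| < e].

Lemma eta_mono th : {mono (fun c => eta c th) : c c' / c <= c'}.
Proof. by apply: le_mono => c c' /(eta_incr th). Qed.

Lemma eta_slice_cts c : continuous (fun x => eta c (circ x)).
Proof.
by apply: (@cts_comp _ _ _ (fun p : R * R => eta p.2 (circ p.1))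
  (fun x => (x, c)) eta_cts); cts.
Qed.

(** With [1 <= M], the same [M] also bounds the angular coordinate on [[0, 1]]. *)
Lemma eta_bounded c c' : exists2 M, 1 <= M &
  forall th, `|eta c th| <= M /\ `|eta c' th| <= M.
Proof.
have bnd c0 : exists M, forall th, `|eta c0 th| <= M.
  have cf : {within `[0, 1], continuous (fun x => `|eta c0 (circ x)|)}.
    by apply: continuous_subspaceT; have cs := @eta_slice_cts c0; cts.
  have [x _ xM] := EVT_max ler01 cf.
  exists `|eta c0 (circ x)| => th; have [y y01 <-] := circ_unit th.
  by apply: xM; rewrite in_itv/=; move: y01; lra.
have [M HM] := bnd c; have [M' HM'] := bnd c'.
exists (1 + `|M| + `|M'|); first by rewrite -addrA lerDl addr_ge0.
move=> th; have := HM th; have := HM' th; have := ler_norm M; have := ler_norm M'.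
have := normr_ge0 M; have := normr_ge0 M'.
by move: `|M| `|M'| `|eta c th| `|eta c' th| => *; split; lra.
Qed.

(** The product [ch(R) al(Theta)] lives between the leaves [c1] and [c2] over [[x1, x2]], so its
    integral is at most that area. By equidistribution it is also at least [2 * (w - 2 * d)] times
    the area between [c1'] and [c2']. One [d] is lost to the approximation and one to the ramp of
    [al]. *)
Lemma area_bound_strict c1 c1' c2' c2 w d m x1 x2 :
  c1 < c1' -> c1' < c2' -> c2' < c2 -> 0 < d -> w <= 2^-1 ->
  0 <= x1 -> x1 <= x2 -> x2 <= 1 ->
  (forall c x z, c1 <= c <= c2 -> 0 <= x <= x1 \/ x2 <= x <= 1 ->
     circ z = (Phi (circ x, eta c (circ x))).1 -> w <= tdist (z - m)) ->
  2 * (w - 2 * d) * (c2' - c1') <=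
  integ (fun x => eta c2 (circ x) - eta c1 (circ x)) x1 x2.
Proof.
move=> l1 l2 l3 d0 w2 x10 x12 x21 Hw.
have c12 : c1 < c2 by lra.
have ce c := @eta_slice_cts c.
have cde : continuous (fun x => eta c2 (circ x) - eta c1 (circ x)).
  by have e1 := ce c1; have e2 := ce c2; cts.
have I0 : 0 <= integ (fun x => eta c2 (circ x) - eta c1 (circ x)) x1 x2.
  rewrite -[leLHS](_ : integ (cst 0) x1 x2 = 0); last by rewrite integ_cst mul0r.
  by apply: le_integ => // [|x _]; [cts|rewrite subr_ge0 ltW// eta_incr].
have [wd|wd] := leP (w - 2 * d) 0.
  apply: le_trans I0; rewrite mulr_le0_ge0//; lra.
have [mid [wid [k [k0 sides inside]]]] := level_window l1 l2 l3 h_mono.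
have [M M1 etaM] := eta_bounded c1 c2.
have e0 : 0 < Num.min d k by rewrite lt_min d0.
have [g [G [lG exG near]]] := exact_approx M e0.
pose Th p := (G p).1; pose Rr p := (G p).2.
(* The approximation errors [k] and [d] are subtracted in advance, so that the supports are correct
   for [G] and not only for [Phi]. *)
pose ch y := trap (wid - k) k `|y - mid|.
pose al z := trap (w - d) d (tdist (z - m)).
have [_ /C1_planeP HT /C1_planeP HR] := lG.
have cT : continuous Th := C1p_continuous HT.
have cR : continuous Rr := C1p_continuous HR.
have cch : continuous ch by apply: cts_trap; cts.
have cal : continuous al.
  apply: cts_trap; apply: (cts_comp (F := @tdist R) (a := fun x => x - m)); last by cts.
  exact: cts_tdist.
have al1 x : al (x + 1) = al x by rewrite /al addrAC -[1]/(1%:~R) tdist_addz.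
have near1 x c : 0 <= x <= 1 -> `|eta c (circ x)| <= M ->
    `|h c - Rr (x, eta c (circ x))| < k /\
    forall z, circ z = (Phi (circ x, eta c (circ x))).1 ->
      tdist (z - m) <= tdist (Th (x, eta c (circ x)) - m) + d.
  move=> x01 rM; have xM : `|x| <= M by rewrite ger0_norm; lra.
  have [n1 n2] := near _ _ xM rM; split.
    by rewrite -(h_level c (circ x)) (lt_le_trans n2)// ge_min lexx orbT.
  move=> z Ez; move: n1; rewrite -Ez => /circle_ballP zT.
  (* Subtracting the nearest integer turns the Lipschitz term into the circle distance between the
     two angles. *)
  have := tdist_lipschitz (z - m)
    (Th (x, eta c (circ x)) - m - (rnd (Th (x, eta c (circ x)) - z))%:~R).
  rewrite -intrN tdist_addz => /le_trans; apply; rewrite lerD2l.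
  rewrite (_ : z - m - _ = z - Th (x, eta c (circ x)) + (rnd (Th (x, eta c (circ x)) - z))%:~R).
    have : tdist (Th (x, eta c (circ x)) - z) < Num.min d k by rewrite -tdistN opprB.
    rewrite /tdist distrC opprB addrC => /ltW /le_trans -> //.
    by rewrite ge_min lexx.
  by rewrite intrN; ring.
have ch0 y : wid - k <= `|y - mid| -> ch y = 0 by exact: trap0.
have outside x c : 0 <= x <= 1 -> `|eta c (circ x)| <= M -> c <= c1 \/ c2 <= c ->
    ch (Rr (x, eta c (circ x))) = 0.
  move=> x01 rM cc; apply: ch0; have [+ _] := near1 x c x01 rM.
  rewrite ltr_norml => /andP[n1 n2]; rewrite ler_normr.
  by case: sides => -[s1 s2]; case: cc => [/s1|/s2] hc; apply/orP; lra.
have inside_band x c : 0 <= x <= 1 -> `|eta c (circ x)| <= M -> c1' <= c <= c2' ->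
    ch (Rr (x, eta c (circ x))) = 1.
  move=> x01 rM cc; apply: trap1 => //; have [+ _] := near1 x c x01 rM.
  have := inside c cc; rewrite ler_norml => /andP[? ?].
  by rewrite ltr_norml => /andP[n1 n2]; rewrite ler_norml; lra.
have far x c : 0 <= x <= x1 \/ x2 <= x <= 1 -> `|eta c (circ x)| <= M ->
    c1 <= c <= c2 -> al (Th (x, eta c (circ x))) = 0.
  move=> xx rM cc; apply: trap0 => //; have x01 : 0 <= x <= 1 by case: xx; lra.
  have [_ n1] := near1 x c x01 rM.
  have [z Ez] := circ_surj (Phi (circ x, eta c (circ x))).1.
  by have := n1 z Ez; have := Hw c x z cc xx Ez; lra.
have chi01 y : 0 <= ch y <= 1 by exact: trap_itv.
have al01 z : 0 <= al z <= 1 by exact: trap_itv.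
have far_side y0 y1 : (mid + wid - k <= y0 /\ mid + wid - k <= y1) \/
    (y0 <= mid - wid + k /\ y1 <= mid - wid + k) -> integ ch 0 y0 = integ ch 0 y1.
  wlog y01 : y0 y1 / y0 <= y1.
    move=> H yy; have [/H|/ltW /H] := leP y0 y1; first exact.
    by move=> -> //; case: yy => -[? ?]; [left|right].
  move=> yy; rewrite -(integ_cat ch 0 y0 y1).
  suff : `|integ ch y0 y1| <= 0 * (y1 - y0).
    by rewrite mul0r normr_le0 => /eqP ->; rewrite addr0.
  apply: norm_integ_le => // y y01'; rewrite ch0 ?normr0//.
  by rewrite ler_normr; apply/orP; case: yy; lra.
(* At heights not strictly between the two outer leaves, the image stays on one side of the support
   of [ch]; this yields the boundary hypotheses of equidistribution at [M] and [- M]. *)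
have const_side s : `|s| <= M ->
    (forall x c, eta c (circ x) = s -> c <= c1) \/
    (forall x c, eta c (circ x) = s -> c2 <= c) ->
    exists v, forall x, integ ch 0 (Rr (x, s)) = v.
  move=> sM sc; exists (integ ch 0 (Rr (0, s))) => x.
  have [k' [x01 ->]] : exists k' : int, 0 <= x - k'%:~R <= 1 /\ x = (x - k'%:~R) + k'%:~R.
    exists (Num.floor x); split; last by ring.
    by have := floor_itv x; rewrite intrD; move: (Num.floor x)%:~R => n; lra.
  rewrite (@periodicz _ _ (fun x => integ ch 0 (Rr (x, s)))); last first.
    by move=> y; rewrite /Rr (lift_periodic lG y s).1.
  set y := x - _ in x01 *.
  have [c Ec] := eta_surj (circ y) s; have [c' Ec'] := eta_surj (circ 0) s.
  have [|n1 _] := near1 y c x01; first by rewrite Ec.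
  have z01 : 0 <= (0 : R) <= 1 by rewrite lexx ler01.
  have [|n2 _] := near1 0 c' z01; first by rewrite Ec'.
  rewrite Ec ltr_norml in n1; rewrite Ec' ltr_norml in n2.
  case/andP: n1 n2 => n1 n1' /andP[n2 n2'].
  apply: far_side; case: sc => sc; have C := sc y c Ec; have C' := sc 0 c' Ec';
    case: sides => -[s1 s2].
  - by right; have := s1 _ C; have := s1 _ C'; lra.
  - by left; have := s1 _ C; have := s1 _ C'; lra.
  - by left; have := s2 _ C; have := s2 _ C'; lra.
  - by right; have := s2 _ C; have := s2 _ C'; lra.
have etaM1 th : - M <= eta c1 th by have [+ _] := etaM th; rewrite ler_norml => /andP[].
have etaM2 th : eta c2 th <= M by have [_ +] := etaM th; rewrite ler_norml => /andP[].
have M0 : 0 <= M by lra.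
have MM : - M <= M by lra.
have top : exists v, forall x, integ ch 0 (Rr (x, M)) = v.
  apply: const_side; first by rewrite ger0_norm.
  by right => x c E; rewrite -(eta_mono (circ x)) E.
have bot : exists v, forall x, integ ch 0 (Rr (x, - M)) = v.
  apply: const_side; first by rewrite normrN ger0_norm.
  by left => x c E; rewrite -(eta_mono (circ x)) E.
have cchR : continuous (fun p => ch (Rr p)) by cts.
have cF : continuous (fun p => ch (Rr p) * al (Th p)) by cts.
have wd0 : 0 <= 2 * (w - 2 * d) by lra.
have dc0 : 0 <= c2' - c1' by lra.
have wd2 : w - 2 * d + d <= 2^-1 by lra.
(* [ch] is 1 between the inner leaves, whose area is [c2' - c1'] by the normalization of [eta]. *)
have lower : c2' - c1' <= dinteg (fun p => ch (Rr p)) 0 1 (- M) M.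
  rewrite fubini_continuous// -[c2']eta_int -[X in _ - X]eta_int -integB//.
  apply: le_integ => // [||x x01]; first by apply: ctsB; exact: ce.
    by apply: (@cts_integ _ _ (fun q => ch (Rr (q.2, q.1)))); cts.
  rewrite /= (_ : _ - _ = integ (cst 1) (eta c1' (circ x)) (eta c2' (circ x))); last first.
    by rewrite integ_cst mul1r.
  have e1 := eta_incr (circ x) l1; have e2 := eta_incr (circ x) l2.
  have e3 := eta_incr (circ x) l3; have := etaM1 (circ x); have := etaM2 (circ x).
  move=> m2 m1; apply: integ_ge_sub; [by cts|by cts|exact: le_trans m1 (ltW e1)|exact: ltW|
    exact: le_trans (ltW e3) m2| |].
    by move=> r _; have /andP[] := chi01 (Rr (x, r)).
  move=> r rr; have [c Ec] := eta_surj (circ x) r.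
  rewrite -Ec (inside_band x c)//; first by rewrite Ec ler_norml; lra.
  by move: rr; rewrite -Ec !eta_mono.
have upper : dinteg (fun p => ch (Rr p) * al (Th p)) 0 1 (- M) M <=
    integ (fun x => eta c2 (circ x) - eta c1 (circ x)) x1 x2.
  rewrite fubini_continuous//.
  have cin : continuous (fun x => integ (fun y => ch (Rr (x, y)) * al (Th (x, y))) (- M) M).
    by apply: (@cts_integ _ _ (fun q => ch (Rr (q.2, q.1)) * al (Th (q.2, q.1)))); cts.
  have rng x r : - M <= r <= M -> exists2 c, eta c (circ x) = r & `|eta c (circ x)| <= M.
    by move=> rM; have [c Ec] := eta_surj (circ x) r; exists c => //; rewrite Ec ler_norml.
  have vanish x : 0 <= x <= x1 \/ x2 <= x <= 1 ->
      integ (fun y => ch (Rr (x, y)) * al (Th (x, y))) (- M) M <= 0.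
    move=> xx; have x01 : 0 <= x <= 1 by case: xx; lra.
    rewrite -(mul0r (M - - M)) -integ_cst; apply: le_integ; [by cts|by cts|exact: MM|] => r rM /=.
    have [c <- cM] := rng x r rM.
    have [cc|cc] := leP c c1; first by rewrite outside ?mul0r//; left.
    have [cc'|cc'] := leP c2 c; first by rewrite outside ?mul0r//; right.
    by rewrite (far x c xx cM) ?mulr0// !ltW.
  apply: integ_le_sub => // x xx; [by apply: vanish; left|by apply: vanish; right|].
  have x01 : 0 <= x <= 1 by lra.
  have -> : eta c2 (circ x) - eta c1 (circ x) =
      integ (cst 1) (eta c1 (circ x)) (eta c2 (circ x)) by rewrite integ_cst mul1r.
  apply: integ_le_sub; [by cts|by cts|exact: etaM1|exact/ltW/eta_incr|exact: etaM2| | |].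
  - move=> r /andP[r1 r2].
    have [|c Ec cM] := rng x r.
      by rewrite r1 (le_trans r2)// (le_trans _ (etaM2 (circ x)))// ltW// eta_incr.
    rewrite -Ec outside ?mul0r//; left.
    by rewrite -(eta_mono (circ x)) Ec.
  - move=> r /andP[r1 r2].
    have [|c Ec cM] := rng x r.
      by rewrite r2 (le_trans (etaM1 (circ x)))// (le_trans _ r1)// ltW// eta_incr.
    rewrite -Ec outside ?mul0r//; right.
    by rewrite -(eta_mono (circ x)) Ec.
  - move=> r _ /=; have /andP[? ?] := chi01 (Rr (x, r)).
    by have /andP[? ?] := al01 (Th (x, r)); exact: mulr_ile1.
have alI : 2 * (w - 2 * d) <= integ al 0 1.
  rewrite (_ : al = (fun x => trap ((w - 2 * d) + d) d (tdist (x - m)))); last first.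
    by apply/funext => z; rewrite /al; congr trap; ring.
  by apply: integ_tdist_trap => //; exact: ltW.
have := exact_equidistribution lG exG cal al1 cch bot top.
rewrite -/Th -/Rr => E.
by apply: le_trans upper; rewrite E; exact: ler_pM.
Qed.

Lemma area_bound c1 c2 w m x1 x2 :
  c1 < c2 -> w <= 2^-1 -> 0 <= x1 -> x1 <= x2 -> x2 <= 1 ->
  (forall c x z, c1 <= c <= c2 -> 0 <= x <= x1 \/ x2 <= x <= 1 ->
     circ z = (Phi (circ x, eta c (circ x))).1 -> w <= tdist (z - m)) ->
  2 * w * (c2 - c1) <=
  integ (fun x => eta c2 (circ x) - eta c1 (circ x)) x1 x2.
Proof.
move=> c12 w2 x10 x12 x21 Hw; set I := integ _ _ _.
apply/ler_addgt0Pr => e e0.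
pose D := c2 - c1; have D0 : 0 < D by rewrite /D subr_gt0.
(* The bound [D / 3] keeps the inner leaves in order. As [w <= 2^-1], shrinking by [s] costs at most
   [2 * s + 4 * s * D], which the other bound makes at most [e]. *)
pose s := Num.min (D / 3) (e / (4 * (D + 1))).
have s0 : 0 < s by rewrite lt_min !divr_gt0// mulr_gt0//; lra.
have sD : s <= D / 3 by rewrite ge_min lexx.
have se : s * (4 * (D + 1)) <= e.
  by rewrite -ler_pdivlMr ?mulr_gt0//; [rewrite ge_min lexx orbT|lra].
have := @area_bound_strict c1 (c1 + s) (c2 - s) c2 w s m x1 x2.
rewrite -/I => /(_ _ _ _ s0 w2 x10 x12 x21 Hw) H.
have {}H : 2 * (w - 2 * s) * (D - 2 * s) <= I.
  by rewrite (_ : D - _ = c2 - s - (c1 + s)); [apply: H; rewrite /D in sD; lra|rewrite /D; ring].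
rewrite -/D; nra.
Qed.

Hypothesis Phi_inj : injective Phi.
Hypothesis Phi_cts : continuous Phi.

Let F (p : R * R) : circle R := (Phi (circ p.1, eta p.2 (circ p.1))).1.

Let F_cts : continuous F.
Proof.
apply: cts_fst; apply: (@cts_comp _ _ _ Phi (fun p : R * R => (circ p.1, eta p.2 (circ p.1)))).
  exact: Phi_cts.
by ctsc.
Qed.

(** Continuity is asked only on a bounded strip, because an approximating map is close to [Phi] only
    on bounded sets of the cover. *)
Definition is_local_lift c0 (g : R * R -> R) :=
  (forall x c, 0 <= x <= 1 -> `|c - c0| < 1 -> {for (x, c), continuous g}) /\
  (forall p, circ (g p) = F p).

(* Among the lifts of a point, take the one nearest to the lift of an
   approximating exact diffeomorphism. *)
Lemma local_lift c0 : exists g, is_local_lift c0 g.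
Proof.
have [M0 M1 HM] := eta_bounded (c0 - 1) (c0 + 1).
(* Two errors of [8^-1] and a variation of [4^-1] of [T] add up to [2^-1], the range in which circle
   distance and real distance of the lifts coincide. *)
have [f [G [lG _ near]]] := @exact_approx (M0 + 1) (8^-1) ltac:(by rewrite invr_gt0).
have [_ /C1_planeP HT _] := lG.
have cT : continuous (fun p => (G p).1) := C1p_continuous HT.
pose T (p : R * R) := (G (p.1, eta p.2 (circ p.1))).1.
have cTT : continuous T.
  by apply: (@cts_comp _ _ _ (fun p => (G p).1)
    (fun p : R * R => (p.1, eta p.2 (circ p.1)))) => //; cts.
pose z p := rep (F p).
pose g p := z p - (rnd (z p - T p))%:~R.
have gF p : circ (g p) = F p by rewrite /g -intrN circ_addz repK.
exists g; split => // x1 c1 x01 c1c0.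
have gT p : `|p.1| <= 2 -> `|p.2 - c0| <= 1 -> `|g p - T p| < 8^-1.
  move=> p1 p2; have etaM : `|eta p.2 (circ p.1)| <= M0 + 1.
    have [] := HM (circ p.1); rewrite !ler_norml => /andP[a1 _] /andP[_ a2].
    have b1 : eta (c0 - 1) (circ p.1) <= eta p.2 (circ p.1).
      by rewrite eta_mono; move: p2; rewrite ler_norml; lra.
    have b2 : eta p.2 (circ p.1) <= eta (c0 + 1) (circ p.1).
      by rewrite eta_mono; move: p2; rewrite ler_norml; lra.
    by move: a1 a2 b1 b2; lra.
  have p1' : `|p.1| <= M0 + 1 by apply: le_trans p1 _; rewrite -lerBlDr; lra.
  have [+ _] := near p.1 _ p1' etaM.
  rewrite -/(T p) -[X in circle_ball X](repK (F p)) => /circle_ballP.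
  by rewrite /tdist /g -/(z p) addrAC.
have cF := @F_cts (x1, c1).
have q4 : 0 < 4^-1 :> R by rewrite invr_gt0.
apply/cvgrPdist_lt => e e0; near=> p.
have pT : `|T (x1, c1) - T p| < 4^-1.
  by near: p; exact: (near_dist (cTT (x1, c1)) q4).
have p1 : `|x1 - p.1| < 1 by near: p; exact: near_fst.
have p2 : `|c1 - p.2| < 1 - `|c1 - c0|.
  by near: p; apply: near_snd; rewrite subr_gt0.
have pF : circle_ball (F (x1, c1)) e (F p).
  near: p; have := cF _ (nbhsx_ballx (F (x1, c1)) _ e0); exact.
have g1 : `|g p - T p| < 8^-1.
  apply: gT; move: p1 p2; rewrite !ltr_norml.
    by rewrite ler_norml => /andP[? ?] _; lra.
  have := ler_norm (c1 - c0); have := ler_norm (- (c1 - c0)); rewrite normrN.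
  by set n := `|_| => ? ? _ /andP[? ?]; rewrite ler_norml; lra.
have g2 : `|g (x1, c1) - T (x1, c1)| < 8^-1.
  by apply: gT => /=; [rewrite ger0_norm; lra|exact: ltW].
have gg : `|g (x1, c1) - g p| <= 2^-1.
  rewrite (_ : _ - _ = (g (x1, c1) - T (x1, c1)) + (T (x1, c1) - T p) - (g p - T p)); last by ring.
  apply: le_trans (ler_normB _ _) _; apply: le_trans (lerD (ler_normD _ _) (lexx _)) _.
  by move: g1 g2 pT; set a := `|_|; set b := `|_|; set c := `|_| => *; lra.
by rewrite -(tdist_small gg); apply/circle_ballP; rewrite !gF.
Unshelve. all: by end_near. Qed.

(** On one leaf the height of the image is constant, so injectivity of [Phi] passes to the angle
    alone. *)
Lemma local_lift_arc c0 g c : is_local_lift c0 g -> `|c - c0| < 1 ->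
  arc_param (fun x => g (x, c)) \/ arc_param (fun x => - g (x, c)).
Proof.
move=> [cg gF] cc0; apply: circ_injective_arc_param.
- move=> x x01; have cgx := cg x c x01 cc0.
  apply: (@continuous_comp _ _ _ (fun x => (x, c)) g) => //.
  exact: (cts_pair (@cts_id _) (@cts_cst _ _ c)).
- move=> x y x01 y01; rewrite !gF /F /= => E.
  have /Phi_inj[] // : Phi (circ x, eta c (circ x)) = Phi (circ y, eta c (circ y)).
  rewrite [LHS]surjective_pairing [RHS]surjective_pairing E.
  by rewrite !h_level.
- have c10 : circ (1 : R) = circ 0 by rewrite -(circ_addz 0 1) add0r.
  by rewrite !gF /F /= c10.
Qed.

Lemma is_derive_leaf_integral c0 g c x : is_local_lift c0 g -> `|c - c0| < 1 ->
  0 <= x <= 1 ->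
  is_derive c 1 (fun c => integ (fun s => eta c (circ s)) 0 x) `|g (x, c) - g (0, c)|.
Proof.
move=> lg cc0 x01; have arc := local_lift_arc lg cc0; case: (lg) => cg gF.
have [] := arc_tdist arc x01; set L := `|_| => L01 arc1 arc2.
have ce := eta_slice_cts.
pose I a b c1 c2 := integ (fun s => eta c2 (circ s) - eta c1 (circ s)) a b.
have IE a b c1 c2 : I a b c1 c2 =
    integ (fun s => eta c2 (circ s)) a b - integ (fun s => eta c1 (circ s)) a b.
  by rewrite -integB.
have Isum c1 c2 : I 0 x c1 c2 + I x 1 c1 c2 = c2 - c1.
  rewrite -[X in X - _](eta_int c2) -[X in _ - X](eta_int c1) !IE.
  by rewrite -!(integ_cat _ 0 x 1); ring.
apply: is_derive_eps => e e0.
have e20 : 0 < e / 2 by rewrite divr_gt0.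
(* Nearby leaves have uniformly close angles, so the arcs of the leaf [c] serve for all of them
   after lowering [w] by [e / 2]. *)
have tb := @tube R R g 0 1 (e / 2) c (fun x x01 => cg x c x01 cc0) e20.
move/nbhs_ballP : tb => [d /= d0 tb].
have key c1 c2 : c1 < c2 -> (forall c', c1 <= c' <= c2 -> `|c - c'| < d) ->
    `|I 0 x c1 c2 - L * (c2 - c1)| <= e * (c2 - c1).
  move=> c12 c12d.
  have bnd (w m x1 x2 : R) : w <= 2^-1 -> 0 <= x1 -> x1 <= x2 -> x2 <= 1 ->
      (forall t, 0 <= t <= x1 \/ x2 <= t <= 1 -> w <= tdist (g (t, c) - m)) ->
      2 * (w - e / 2) * (c2 - c1) <= I x1 x2 c1 c2.
    move=> w2 x10 x12 x21 Hw.
    apply: (area_bound (m := m)) => //.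
      by move: w2 e20; lra.
    move=> c' t z c'12 tt Ez.
    rewrite (@circ_tdist _ z (g (t, c'))); last by rewrite gF.
    have t01 : 0 <= t <= 1 by case: tt; move: x10 x12 x21; lra.
    have := tb c' (c12d _ c'12) t t01; have := Hw t tt.
    have := tdist_lipschitz (g (t, c) - m) (g (t, c') - m).
    rewrite (_ : _ - m - _ = g (t, c) - g (t, c')); last by ring.
    rewrite [`|g (t, c) - _|]distrC; set a := tdist _; set b := tdist _; set n := `|_|.
    lra.
  have [x0 x1] := andP x01; have [L0 L1] := andP L01.
  have B1 : 2 * (L / 2 - e / 2) * (c2 - c1) <= I 0 x c1 c2.
    by apply: bnd arc1 => //; move: L1; lra.
  have B2 : 2 * ((1 - L) / 2 - e / 2) * (c2 - c1) <= I x 1 c1 c2.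
    by apply: bnd arc2 => //; move: L0; lra.
  (* The total being [c2 - c1], the lower bound over [[x, 1]] is an upper bound over [[0, x]]. *)
  have S := Isum c1 c2; rewrite ler_norml.
  move: B1 B2 S; move: (I 0 x c1 c2) (I x 1 c1 c2) => i j; move: (L) (e) (c2) (c1).
  by move=> L' e' c2' c1' *; lra.
apply/nbhs_ballP; exists d => //= c' cc'.
have [cc|cc|<-] := ltgtP c c'; last by rewrite !subrr mulr0 subrr normr0 mulr0.
  have := key c c' cc; rewrite IE [`|c' - c|]ger0_norm ?subr_ge0 ?(ltW cc)//; apply.
  move=> c'' /andP[h1 h2]; apply: le_lt_trans cc'.
  by rewrite !ler0_norm ?subr_le0 ?(ltW cc)//; move: h1 h2; lra.
rewrite [`|c' - c|]ler0_norm ?subr_le0 ?(ltW cc)// [X in _ <= _ * X]opprB.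
rewrite (_ : _ - _ = - (I 0 x c' c - L * (c - c'))); last by rewrite IE; ring.
rewrite normrN; apply: key => // c'' /andP[h1 h2]; apply: le_lt_trans cc'.
by rewrite !ger0_norm ?subr_ge0 ?(ltW cc)//; move: h1 h2; lra.
Qed.

Let U (p : R * R) := integ (fun s => eta p.2 (circ s)) 0 p.1 - p.2 * p.1.

Let U_periodic c x : U (x + 1, c) = U (x, c).
Proof.
have e1 y : eta c (circ (y + 1)) = eta c (circ y) by rewrite -[1]/(1%:~R) circ_addz.
have := integ_periodic x 1 (@eta_slice_cts c) e1.
rewrite /U /= -(integ_cat _ 0 x (x + 1)) => ->.
by rewrite eta_int; ring.
Qed.

Let U_periodicz c x (k : int) : U (x + k%:~R, c) = U (x, c).
Proof. exact: (@periodicz _ _ (fun x => U (x, c)) (U_periodic c)). Qed.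

Let is_derive_U c0 g c x : is_local_lift c0 g -> `|c - c0| < 1 -> 0 <= x <= 1 ->
  is_derive c 1 (fun c => U (x, c)) (`|g (x, c) - g (0, c)| - x).
Proof.
move=> lg cc0 x01.
have d1 := is_derive_leaf_integral lg cc0 x01.
have d2 := is_derive_mulr x (is_derive_id c 1); rewrite mul1r in d2.
exact: (is_deriveB d1 d2).
Qed.

Let unit_shift (x : R) : exists k : int, 0 <= x - k%:~R < 1.
Proof.
exists (Num.floor x); have := floor_itv x; rewrite intrD; move: (Num.floor x)%:~R => n.
by lra.
Qed.

Let derivable_U x c : derivable (fun c => U (x, c)) c 1.
Proof.
have [k /andP[xk1 xk2]] := unit_shift x; have [g lg] := local_lift c.
have -> : (fun c => U (x, c)) = (fun c => U (x - k%:~R, c)).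
  by apply/funext => z; rewrite -[in RHS](U_periodicz _ _ k) subrK.
have cc : `|c - c| < 1 by rewrite subrr normr0.
have xk : 0 <= x - k%:~R <= 1 by rewrite xk1 ltW.
by have [] := is_derive_U lg cc xk.
Qed.

Let dyU c0 g c x : is_local_lift c0 g -> `|c - c0| < 1 -> 0 <= x <= 1 ->
  dy U (x, c) = `|g (x, c) - g (0, c)| - x.
Proof.
by move=> lg cc0 x01; have [_ <-] := is_derive_U lg cc0 x01; rewrite /dy derive1E.
Qed.

Let dyU_periodic c x (k : int) : dy U (x + k%:~R, c) = dy U (x, c).
Proof.
rewrite /dy /=; suff -> : (fun z => U (x + k%:~R, z)) = (fun z => U (x, z)) by [].
by apply/funext => z; exact: U_periodicz.
Qed.

Let dyU_cts : continuous (dy U).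
Proof.
move=> [x0 c0]; have [g lg] := local_lift c0; have [cg gF] := lg.
have cc : `|c0 - c0| < 1 by rewrite subrr normr0.
pose f (p : R * R) := `|g p - g (0, p.2)| - p.1.
have cf x : 0 <= x <= 1 -> {for (x, c0), continuous f}.
  move=> x01; apply: cvgB; last exact: cvg_fst.
  apply: cvg_norm; apply: cvgB; first exact: cg.
  apply: (@continuous_comp _ _ _ (fun p : R * R => (0, p.2)) g).
    by apply: (cts_pair (@cts_cst _ _ 0)) => p; exact: cvg_snd.
  by apply: cg => //; rewrite lexx ler01.
have near_c : \forall p \near (x0, c0), `|c0 - p.2| < 1 by exact: near_snd.
have [k /andP[y0 y1]] := unit_shift x0; set y := x0 - k%:~R in y0 y1.
have x0E : x0 = y + k%:~R by rewrite subrK.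
have shift_near (l : int) (P : R * R -> Prop) :
    (\forall p \near (x0 - l%:~R, c0), P p) -> \forall p \near (x0, c0), P (p.1 - l%:~R, p.2).
  have cs : continuous (fun p : R * R => (p.1 - l%:~R, p.2)) by cts.
  by move=> H; exact: (cs (x0, c0)).
have y01 : 0 <= y <= 1 by rewrite y0 ltW.
apply/cvgrPdist_lt => e e0.
have v0 : dy U (x0, c0) = f (y, c0) by rewrite x0E dyU_periodic (dyU lg).
(* At an integer the formula of [dyU] changes period: on the right the local coordinate is near 0,
   on the left near 1. The two expressions match because [f] vanishes at both ends, the leaf making
   exactly one turn. *)
have [yz|yp] := eqVneq y 0.
- have f0 : f (0, c0) = 0 by rewrite /f /= subrr normr0 subr0.
  have f1 : f (1, c0) = 0.
    have [] := local_lift_arc lg cc; rewrite /arc_param /f /= => -[_ E].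
      by rewrite (_ : g (1, c0) - _ = 1) ?normr1 ?subrr// E; ring.
    by rewrite (_ : g (1, c0) - _ = - 1) ?normrN1 ?subrr//; lra.
  rewrite v0 yz f0.
  have z01 : 0 <= (0 : R) <= 1 by rewrite lexx ler01.
  have o01 : 0 <= (1 : R) <= 1 by rewrite lexx ler01.
  have n0 : \forall p \near (x0 - k%:~R, c0), `|f p| < e.
    rewrite -/y yz; apply: filterS (near_dist (cf 0 z01) e0) => p.
    by rewrite f0 sub0r normrN.
  have n1 : \forall p \near (x0 - (k - 1)%:~R, c0), `|f p| < e.
    rewrite (_ : x0 - _ = 1); last by rewrite intrB opprB addrCA -/y yz addr0.
    apply: filterS (near_dist (cf 1 o01) e0) => p.
    by rewrite f1 sub0r normrN.
  near=> p; rewrite sub0r normrN.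
  have m0 : `|f (p.1 - k%:~R, p.2)| < e by near: p; exact: (shift_near k _ n0).
  have m1 : `|f (p.1 - (k - 1)%:~R, p.2)| < e by near: p; exact: (shift_near (k - 1) _ n1).
  have pc : `|p.2 - c0| < 1 by rewrite distrC; near: p.
  have px : `|x0 - p.1| < 1 by near: p; exact: near_fst.
  have x0k : x0 = k%:~R by rewrite x0E yz add0r.
  rewrite x0k ltr_norml in px; case/andP: px => px1 px2.
  rewrite [p]surjective_pairing.
  have [pk|pk] := leP 0 (p.1 - k%:~R).
    rewrite -[p.1](subrK k%:~R) dyU_periodic (dyU lg)//.
    by rewrite pk; move: px1; lra.
  rewrite -[p.1](subrK (k - 1)%:~R) dyU_periodic (dyU lg)//.
  by rewrite intrB; move: px2 pk; set q := k%:~R => *; lra.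
- have yp' : 0 < y by rewrite lt_neqAle eq_sym yp.
  have n0 : \forall p \near (x0 - k%:~R, c0), `|f (y, c0) - f p| < e.
    exact: (near_dist (cf y y01) e0).
  have n2 : \forall p \near (x0 - k%:~R, c0), `|y - p.1| < Num.min y (1 - y).
    apply: near_fst.
    by rewrite lt_min yp' subr_gt0.
  near=> p; rewrite v0.
  have m0 : `|f (y, c0) - f (p.1 - k%:~R, p.2)| < e by near: p; exact: (shift_near k _ n0).
  have m2 : `|y - (p.1 - k%:~R)| < Num.min y (1 - y) by near: p; exact: (shift_near k _ n2).
  have pc : `|p.2 - c0| < 1 by rewrite distrC; near: p.
  rewrite [in dy U p](surjective_pairing p) -[p.1](subrK k%:~R) dyU_periodic (dyU lg)//.
  move: m2; rewrite lt_min !ltr_norml => /andP[/andP[a b] /andP[c d]].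
  by move: a b c d; set q := p.1 - _; lra.
Unshelve. all: by end_near. Qed.

Lemma generating_function_exists : exists u : annulus R -> R,
  [/\ C1_annulus u, forall r : R, u (0, r) = 0,
      forall (theta : circle R) (c : R), eta c theta = c + dtheta u (theta, c) &
      forall c : R, homeomorphism
        (fun theta : circle R => theta + circ (dr u (theta, c)))].
Proof.
pose u (p : annulus R) := U (rep p.1, p.2).
have uU p : u (covering p) = U p.
  by case: p => x c; rewrite /u /=; exact: (@rep_circ _ _ (fun x => U (x, c)) (U_periodic c)).
have uUf : (fun p => u (covering p)) = U by apply/funext.
have HU : C1p U (fun p => eta p.2 (circ p.1) - p.2) (dy U).
  split; [| | by cts|exact: dyU_cts] => x c.
  - have d1 := is_derive_integ_ub 0 x (@eta_slice_cts c).
    have d2 : is_derive x 1 (fun y : R => c * y) c.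
      by have := is_deriveZ c (is_derive_id x 1); rewrite [c *: _]mulr1.
    exact: (is_deriveB d1 d2).
  - apply: DeriveDef; first exact: derivable_U.
    by rewrite -derive1E.
have C1u : C1_annulus u by rewrite /C1_annulus uUf; exact: C1p_plane HU.
have dru x c : dr u (circ x, c) = dy U (x, c).
  by rewrite -uUf.
exists u; split => //.
- by move=> r; rewrite -(@circ0 R) -[(circ 0, r)]/(covering (0, r)) uU /U /= integ_id mulr0 subr0.
- move=> th c; have [x <-] := circ_surj th.
  rewrite -[(circ x, c)]/(covering (x, c)) dtheta_covering// uUf (C1p_dx HU) /=.
  by ring.
- move=> c; apply: (@fibre_homeomorphism _ (fun p => p.1 + circ (dr u p))).
  apply: circle_bundle_homeomorphism.
    apply: cts_descend (@open_onto_covering R) _.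
    by rewrite (_ : (fun _ => _) = dy U)//; apply/funext => -[x c']; exact: dru.
  move=> c' th th'; have [x /andP[x0 x1] <-] := circ_unit th.
  have [y /andP[y0 y1] <-] := circ_unit th'.
  have [g lg] := local_lift c'; have cc : `|c' - c'| < 1 by rewrite subrr normr0.
  have x01 : 0 <= x <= 1 by rewrite x0 ltW.
  have y01 : 0 <= y <= 1 by rewrite y0 ltW.
  (* What remains is [|g (x, c') - g (0, c')|]: up to rotation and orientation the twist map is the
     angle on the image leaf. *)
  rewrite !dru !(dyU lg)// -!circD !(addrC _ (_ - _)) !subrK => E.
  have gE : circ (g (x, c')) = circ (g (y, c')).
    have [[mg _]|[mg _]] := local_lift_arc lg cc.
      have pos z : 0 <= z -> z < 1 -> 0 <= g (z, c') - g (0, c').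
        rewrite le_eqVlt => /predU1P[<-|z0 z1]; first by rewrite subrr.
        by rewrite subr_ge0 ltW// mg// ltW.
      move: E; rewrite !ger0_norm ?pos// => /circ_intP[k E].
      by apply/circ_intP; exists k; move: E; move: (g _) (g _) (g _) k%:~R; move=> *; lra.
    have neg z : 0 <= z -> z < 1 -> g (z, c') - g (0, c') <= 0.
      rewrite le_eqVlt => /predU1P[<-|z0 z1]; first by rewrite subrr.
      by rewrite subr_le0 -lerN2 ltW// mg// ltW.
    move: E; rewrite !ler0_norm ?neg// => /circ_intP[k E].
    apply/circ_intP; exists (- k); rewrite intrN.
    by move: E; move: (g _) (g _) (g _) k%:~R; move=> *; lra.
  case: lg => _ gF; rewrite !gF /F /= in gE.
  have /Phi_inj[] // : Phi (circ x, eta c' (circ x)) = Phi (circ y, eta c' (circ y)).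
  by rewrite [LHS]surjective_pairing [RHS]surjective_pairing gE !h_level.
Qed.

End GeneratingFunction.

Section UniformBall.
Variables (R : realType) (X : choiceType) (Y : pseudoMetricType R).

Lemma uniform_ballP (U : set X) (f : nat -> X -> Y) (g : X -> Y) :
  {uniform U, f @ \oo --> g} <->
  forall e : R, 0 < e -> \forall n \near \oo, forall p, U p -> ball (g p) e (f n p).
Proof.
split=> [cf e e0|H P /uniform_nbhs [E [entE EP]]].
  have : nbhs (g : {uniform` U -> Y}) [set k : X -> Y | forall p, U p -> ball (g p) e (k p)].
    apply/uniform_nbhs; exists [set pq : Y * Y | ball pq.1 e pq.2].
    by split; [exact: entourage_ball (PosNum e0)|].
  by move=> /cf.
move: entE; rewrite -entourage_ballE => -[e /= e0 eE].
by apply: filterS (H e e0) => n Hn; apply: EP => p Up; apply: eE; exact: Hn.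
Qed.

End UniformBall.

(** * Order of the leaves and the direct implication *)

Section Foliation.
Variables (R : realType) (eta : R -> circle R -> R).
Hypothesis eta_foliation : C0_foliation eta.
Hypothesis eta_integral : forall c : R, circle_integral (eta c) = c.

Lemma foliation_cts : continuous (fun p : R * R => eta p.2 (circ p.1)).
Proof.
have [_ [A [_ _ cA _]]] := eta_foliation.
have c2 := cts_snd cA.
exact: (@cts_comp _ _ _ (fun p : annulus R => eta p.2 p.1) (@covering R) c2 (@cts_covering R)).
Qed.

Lemma foliation_integ c : integ (fun x => eta c (circ x)) 0 1 = c.
Proof.
rewrite -[RHS]eta_integral /circle_integral integ_Rintegral ?ler01//.
exact: eta_slice_cts foliation_cts c.
Qed.

Lemma foliation_inj c c' th : eta c th = eta c' th -> c = c'.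
Proof.
have [_ [A [fK _ _ _]]] := eta_foliation => E.
by have := fK (th, c); rewrite /= E (fK (th, c')) => -[].
Qed.

Lemma foliation_surj th r : exists c, eta c th = r.
Proof.
have [_ [A [_ gK _ _]]] := eta_foliation.
by have := gK (th, r); case: (A (th, r)) => th' c /= [<-] E; exists c.
Qed.

(** Distinct leaves are disjoint, so their difference has constant sign; its integral [c' - c] says
    which. *)
Lemma foliation_incr c c' th : c < c' -> eta c th < eta c' th.
Proof.
move=> cc'; rewrite ltNge; apply/negP => le0.
pose e x := eta c' (circ x) - eta c (circ x).
have ce : continuous e.
  by apply: ctsB; exact: (@eta_slice_cts _ _ foliation_cts).
have e_neq0 x : e x != 0.
  apply: contra_ltN cc' => /eqP/subr0_eq/foliation_inj ->; exact: lexx.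
have [x0 x0E] := circ_surj th.
have ex0 : e x0 <= 0 by rewrite /e x0E subr_le0.
have e_le0 x : e x <= 0.
  rewrite leNgt; apply/negP => ex.
  have cw a b : {within `[a, b], continuous e} by exact: continuous_subspaceT.
  have [xx|xx] := leP x0 x.
    have [|y _ Ey] := @IVT _ _ _ _ 0 xx (cw _ _); last by have := e_neq0 y; rewrite Ey eqxx.
    by rewrite ge_min le_max ex0 (ltW ex) orbT.
  have [|y _ Ey] := @IVT _ _ _ _ 0 (ltW xx) (cw _ _); last by have := e_neq0 y; rewrite Ey eqxx.
  by rewrite ge_min le_max ex0 (ltW ex) orbT.
have c0 : continuous (cst 0 : R -> R) by cts.
have := le_integ ce c0 ler01 (fun x _ => e_le0 x).
rewrite integB; [|exact: (@eta_slice_cts _ _ foliation_cts)..].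
by rewrite !foliation_integ integ_cst mul0r leNgt subr_gt0 cc'.
Qed.

Lemma generating_function_of_straightening :
  exact_symp_homeomorphic_to_standard eta ->
  exists u : annulus R -> R,
    [/\ C1_annulus u, forall r : R, u (0, r) = 0,
        forall (theta : circle R) (c : R), eta c theta = c + dtheta u (theta, c) &
        forall c : R, homeomorphism
          (fun theta : circle R => theta + circ (dr u (theta, c)))].
Proof.
move=> [Phi [[Psi [PhiK _ cPhi _]] [f exf ucf]] leavesE].
pose h c := (Phi (circ 0, eta c (circ 0))).2.
have image c : Phi @` [set p | p.2 = eta c p.1] = [set p | p.2 = h c].
  have : (leaves (@standard_foliation R)) (Phi @` [set p | p.2 = eta c p.1]).
    by rewrite -leavesE; exists [set p | p.2 = eta c p.1] => //; exists c.
  move=> [c' _]; rewrite /standard_foliation => E; rewrite -E; congr mkset.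
  apply/funext => p; congr (_ = _).
  have : (Phi @` [set p | p.2 = eta c p.1]) (Phi (circ 0, eta c (circ 0))).
    by exists (circ 0, eta c (circ 0)).
  by rewrite -E.
have h_level c th : (Phi (th, eta c th)).2 = h c.
  have : (Phi @` [set p | p.2 = eta c p.1]) (Phi (th, eta c th)).
    by exists (th, eta c th).
  by rewrite image.
have Phi_inj : injective Phi by exact: can_inj PhiK.
have h_inj : injective h.
  move=> c c' E.
  have : (Phi @` [set p | p.2 = eta c p.1]) (Phi (circ 0, eta c (circ 0))).
    by exists (circ 0, eta c (circ 0)).
  rewrite image E -image => -[[th r] /= rE /Phi_inj[thE rE']].
  by apply: (@foliation_inj _ _ (circ 0)); rewrite -rE' rE thE.
have h_cts : continuous h.
  apply: cts_snd; apply: (@cts_comp _ _ _ Phi (fun c => (circ 0, eta c (circ 0)))).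
    exact: cPhi.
  apply: cts_pair; first exact: cts_cst.
  apply: (@cts_comp _ _ _ (fun p : R * R => eta p.2 (circ p.1)) (fun c => (0, c))).
    exact: foliation_cts.
  by cts.
have h_mono : (forall x y, x < y -> h x < h y) \/ (forall x y, x < y -> h y < h x).
  have [m|m] := @itv_continuous_inj_mono R h `]-oo, +oo[
    (continuous_subspaceT h_cts) (in2W h_inj); [left|right] => x y xy;
    by apply: m; rewrite ?in_itv.
apply: (generating_function_exists foliation_cts foliation_integ foliation_incr
  foliation_surj h_level h_mono _ Phi_inj cPhi) => M e e0.
pose K : set (R * R) := `[- M, M]%classic `*` `[- M, M]%classic.
have cK : compact K by apply: compact_setX; exact: segment_compact.
(* Compactness of the square replaces the neighbourhoods of single points by one rank. *)
have : \forall n \near \oo, K `<=` (fun p => ball (Phi (covering p)) e (f n (covering p))).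
  apply: ((compact_near_coveringP _).1 cK) => p _.
  have [U nU /uniform_ballP/(_ e e0) nf] := ucf (covering p).
  have nU' : \forall q \near p, U (covering q) by exact: (@cts_covering R p).
  exists ([set q | U (covering q)], [set n | forall q, U q -> ball (Phi q) e (f n q)]) => //=.
  by move=> [q n] /= [Uq Hn]; exact: Hn.
move=> [N _ /(_ N (leqnn N)) HN].
have [_ _ [G lG exG]] := exf N.
exists (f N), G; split => // x r xM rM.
have [] : ball (Phi (covering (x, r))) e (f N (covering (x, r))).
  by apply: HN; split; rewrite /= in_itv/= -ler_norml.
by case: (lG) => [<- _ _].
Qed.

End Foliation.

(** * From a generating function to a straightening *)

Section GeneratedDiffeomorphism.
Variable R : realType.
Implicit Types F : R * R -> R.

Lemma C1p_periodic F Fx Fy : C1p F Fx Fy ->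
  (forall x c, F (x + 1, c) = F (x, c)) ->
  (forall x c, Fx (x + 1, c) = Fx (x, c)) /\ (forall x c, Fy (x + 1, c) = Fy (x, c)).
Proof.
move=> [d1 d2 _ _] F1; split=> x c.
- have := is_derive_shiftr (d1 (x + 1) c).
  rewrite (_ : (fun t => F (t + 1, c)) = (fun t => F (t, c))); last first.
    by apply/funext => t; exact: F1.
  by move=> /(is_derive_uniq (d1 x c)).
- have := d2 (x + 1) c.
  rewrite (_ : (fun t => F (x + 1, t)) = (fun t => F (x, t))); last first.
    by apply/funext => t; exact: F1.
  by move=> /(is_derive_uniq (d2 x c)).
Qed.

Definition descend (V : Type) (F : R * R -> V) (p : annulus R) : V := F (rep p.1, p.2).

Lemma descendE (V : Type) (F : R * R -> V) : (forall x c, F (x + 1, c) = F (x, c)) ->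
  forall p, descend F (covering p) = F p.
Proof.
move=> F1 [x c]; rewrite /descend /=.
exact: (@rep_circ _ _ (fun x => F (x, c)) (fun x => F1 x c)).
Qed.

Lemma cts_descend_covering (V : topologicalType) (F : R * R -> V) : continuous F ->
  (forall x c, F (x + 1, c) = F (x, c)) -> continuous (descend F).
Proof.
move=> cF F1; apply: cts_descend (@open_onto_covering R) _.
by rewrite (_ : (fun _ => _) = F)//; apply/funext => p; exact: descendE.
Qed.

Variables (S P Q Px m Qy : R * R -> R) (d : R).
Hypotheses (HS : C1p S P Q) (HP : C1p P Px m) (HQ : C1p Q m Qy).
Hypotheses (d0 : 0 < d) (dm : forall p, d <= 1 + m p).
Hypothesis S1 : forall x c, S (x + 1, c) = S (x, c).

(* The generating function [S] maps [(x, c + P(x, c))] to [(x + Q(x, c), c)]; the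
   primitive of the pulled-back Liouville form is [c Q - S]. *)
Lemma generated_exact_diffeo : exists g C,
  [/\ exact_symplectic_diffeo g,
      forall x r, C (x, r) + P (x, C (x, r)) = r &
      forall x r, g (circ x, r) = (circ (x + Q (x, C (x, r))), C (x, r))].
Proof.
have [P1 Q1] := C1p_periodic HS S1.
have HF1 : C1p (fun p => p.2 + P p) (fun p => 0 + Px p) (fun p => 1 + m p).
  exact: (C1pD (C1p_snd R) HP).
have HF2 : C1p (fun p => p.1 + Q p) (fun p => 1 + m p) (fun p => 0 + Qy p).
  exact: (C1pD (C1p_fst R) HQ).
have [C [FC CF HC]] := implicit_function HF1 d0 dm.
(* Solves [x + Q (x, c) = y] for [x]. The symmetry of the mixed derivative [m] lets the same bound
   invert both equations. *)
have [X' [FX XF HX']] := implicit_function (C1p_swap HF2) d0 (fun p => dm (swap p)).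
set Cx := (fun p => - _) in HC; set Cy := (fun p => _^-1) in HC.
have HX := C1p_swap HX'; rewrite /comp /swap /= in HX.
rewrite /= in FC CF FX XF.
have C1 x r : C (x + 1, r) = C (x, r) by rewrite -{1}(FC x r) -P1 CF.
have X1 y c : X' (c, y + 1) = X' (c, y) + 1.
  by rewrite -{1}(FX c y) addrAC -Q1 XF.
pose G (p : R * R) := (p.1 + Q (p.1, C p), C p).
pose H (p : R * R) := (X' (p.2, p.1), p.2 + P (X' (p.2, p.1), p.2)).
have HQC : C1p (fun p => Q (p.1, C p)) _ _ := C1p_comp2 HQ (C1p_fst R) HC.
have HPX : C1p (fun p => P (X' (p.2, p.1), p.2)) _ _ := C1p_comp2 HP HX (C1p_snd R).
have HG1 : C1p (fun p => (G p).1) _ _ := C1pD (C1p_fst R) HQC.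
have HH2 : C1p (fun p => (H p).2) _ _ := C1pD (C1p_snd R) HPX.
have GH p : G (H p) = p.
  by case: p => y c; rewrite /G /H /= CF; congr (_, _); exact: (FX c y).
have HG p : H (G p) = p.
  by case: p => x r; rewrite /G /H /= XF FC.
have cG1 x c : covering (G (x + 1, c)) = covering (G (x, c)).
  by rewrite /covering /G /= C1 Q1 addrAC (circ_addz _ 1).
have cH1 x c : covering (H (x + 1, c)) = covering (H (x, c)).
  by rewrite /covering /H /= X1 P1 (circ_addz _ 1).
pose g := descend (fun p => covering (G p)).
pose h := descend (fun p => covering (H p)).
have gE p : g (covering p) = covering (G p) by exact: (descendE cG1).
have hE p : h (covering p) = covering (H p) by exact: (descendE cH1).
have [surj _] := @open_onto_covering R.
have lG : C1_lift G g.
  by split; [move=> p; rewrite gE|exact: C1p_plane HG1|exact: C1p_plane HC].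
exists g, C; split; last 2 first.
- exact: FC.
- by move=> x r; rewrite -[(circ x, r)]/(covering (x, r)) gE.
split.
- exists h; split.
  + by move=> q; have [p <-] := surj q; rewrite gE hE HG.
  + by move=> q; have [p <-] := surj q; rewrite hE gE GH.
  + by exists G.
  + exists H; split; [by move=> p; rewrite hE|exact: C1p_plane HX|exact: C1p_plane HH2].
- have cQC := C1p_continuous HQC; have cC := C1p_continuous HC.
  pose q := descend (fun p => Q (p.1, C p)); pose k := descend C.
  have q1 x c : Q ((x + 1, c).1, C (x + 1, c)) = Q ((x, c).1, C (x, c)) by rewrite /= C1 Q1.
  have cq : continuous q by exact: cts_descend_covering cQC q1.
  have ck : continuous k by exact: cts_descend_covering cC C1.
  (* The angular displacement is periodic, hence a real function on the annulus, and can be scaled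
     by the time. *)
  exists (fun tp => (tp.2.1 + circ (tp.1 * q tp.2), tp.2.2 + tp.1 * (k tp.2 - tp.2.2))); split.
  + apply: continuous_subspaceT; apply: cts_pair; last by cts.
    apply: (@cts_comp2 _ _ _ _ _ (fun tp : R * annulus R => tp.2.1)
      (fun tp => circ (tp.1 * q tp.2)) (@cts_circD R)); first by cts.
    by ctsc.
  + by move=> [th r]; rewrite /= !mul0r circ0 !addr0.
  + move=> p; have [[x r] <-] := surj p; rewrite gE /q /k /= !mul1r.
    rewrite (descendE q1) (descendE C1) /= -circD.
    by rewrite /covering /G /= [r + _]addrC subrK.
- exists G; first exact: lG.
  pose T p := C p * Q (p.1, C p) - S (p.1, C p).
  have T1 x c : T (x + 1, c) = T (x, c) by rewrite /T /= C1 Q1 S1.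
  have HT : C1p T _ _ := C1pB (C1pM HC HQC) (C1p_comp2 HS (C1p_fst R) HC).
  have TE : (fun p => descend T (covering p)) = T.
    by apply/funext => p; exact: descendE.
  have C1T : C1_annulus (descend T) by rewrite /C1_annulus TE; exact: C1p_plane HT.
  exists (descend T) => // p.
  have -> : dr (descend T) (covering p) = dy T p by rewrite -[in RHS]TE.
  rewrite dtheta_covering// TE (C1p_dx HT) (C1p_dy HT).
  rewrite /pullback_liouville /liouville (C1p_dx HG1) (C1p_dy HG1) /=.
  have E : P (p.1, C p) = p.2 - C p by case: p => x r; rewrite /= -{2}(FC x r); ring.
  by congr (_, _); rewrite /= ?E; ring.
Qed.

End GeneratedDiffeomorphism.

(** * Steklov averages *)

Section Steklov.
Variable R : realType.
Implicit Types F : R * R -> R.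

Lemma C1p_primitive_y F Fx : continuous F -> continuous Fx ->
  (forall x y : R, is_derive x 1 (fun t => F (t, y)) (Fx (x, y))) ->
  C1p (fun p => integ (fun t => F (p.1, t)) 0 p.2)
      (fun p => integ (fun t => Fx (p.1, t)) 0 p.2) F.
Proof.
move=> cF cFx dF; split; [| | |by []] => [x y|x y|].
- apply: (@is_derive_integ R (fun q => F (q.2, q.1)) (fun q => Fx (q.2, q.1))) => [||t s];
    [by cts|by cts|exact: dF].
- have c : continuous (fun t => F (x, t)) by cts.
  exact: (is_derive_integ_ub 0 y c).
- by apply: (@cts_integ_to _ _ (fun q => Fx (q.2.1, q.1)) 0 (fun p => p.2)); cts.
Qed.

Lemma C1p_primitive_x F Fy : continuous F -> continuous Fy ->
  (forall x y : R, is_derive y 1 (fun t => F (x, t)) (Fy (x, y))) ->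
  C1p (fun p => integ (fun s => F (s, p.2)) 0 p.1) F
      (fun p => integ (fun s => Fy (s, p.2)) 0 p.1).
Proof.
move=> cF cFy dF; split; [| |by []|] => [x y|x y|].
- have c : continuous (fun t => F (t, y)) by cts.
  exact: (is_derive_integ_ub 0 x c).
- exact: (@is_derive_integ R F Fy 0 x y cF cFy dF).
- by apply: (@cts_integ_to _ _ (fun q => Fy (q.1, q.2.2)) 0 (fun p => p.1)); cts.
Qed.

Lemma C1p_shift F Fx Fy (a b : R) : C1p F Fx Fy ->
  C1p (fun p => F (p.1 + a, p.2 + b)) (fun p => Fx (p.1 + a, p.2 + b))
    (fun p => Fy (p.1 + a, p.2 + b)).
Proof.
move=> [d1 d2 c1 c2]; split; [| |by cts|by cts] => x y.
- exact: (is_derive_shiftr (d1 (x + a) (y + b))).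
- exact: (is_derive_shiftr (d2 (x + a) (y + b))).
Qed.

(** A scaled mixed second difference over a square of side [h]. The terms [+ 0] make every corner an
    instance of [C1p_shift]. *)
Definition box_diff (k h : R) F (p : R * R) : R :=
  (F (p.1 + h, p.2 + h) - F (p.1 + h, p.2 + 0)
   - (F (p.1 + 0, p.2 + h) - F (p.1 + 0, p.2 + 0))) * k.

Lemma C1p_box_diff k h F Fx Fy : C1p F Fx Fy ->
  C1p (box_diff k h F) (box_diff k h Fx) (box_diff k h Fy).
Proof.
move=> HF.
have := C1pM (C1pB (C1pB (C1p_shift h h HF) (C1p_shift h 0 HF))
                   (C1pB (C1p_shift 0 h HF) (C1p_shift 0 0 HF))) (C1p_cst k).
move=> H; apply: (C1p_eq H) => p; rewrite /box_diff /= ?mulr0 ?addr0//.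
Qed.

Variables U Ux Uy : R * R -> R.
Hypothesis HU : C1p U Ux Uy.
Hypothesis U1 : forall x c, U (x + 1, c) = U (x, c).
Hypothesis U_mono : forall x y c, x <= y -> x + Uy (x, c) <= y + Uy (y, c).

(** [W] has partial derivatives [V] and [Y], and mixed derivative [U]. A box difference of [W] is
    therefore an average of [U] whose derivatives are box differences of [V], [Y] and [U]. *)
Let V p := integ (fun t => U (p.1, t)) 0 p.2.
Let Y p := integ (fun s => U (s, p.2)) 0 p.1.
Let W p := integ (fun s => V (s, p.2)) 0 p.1.

Let HV : C1p V (fun p => integ (fun t => Ux (p.1, t)) 0 p.2) U.
Proof. by case: (HU) => [d1 _ c1 _]; exact: C1p_primitive_y (C1p_continuous HU) c1 d1. Qed.

Let HY : C1p Y U (fun p => integ (fun s => Uy (s, p.2)) 0 p.1).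
Proof. by case: (HU) => [_ d2 _ c2]; exact: C1p_primitive_x (C1p_continuous HU) c2 d2. Qed.

Let HW : C1p W V Y.
Proof.
by case: HV => [_ d2 _ _]; exact: C1p_primitive_x (C1p_continuous HV) (C1p_continuous HU) d2.
Qed.

(* Steklov averages [h^-2 int int U] over squares of side [h], damped by [1 - h]
   so that the twist [1 + d_x d_c] is bounded below by [h]. *)
Definition steklov_coef (h : R) := (1 - h) / h ^+ 2.

Let S h := box_diff (steklov_coef h) h W.
Let P h := box_diff (steklov_coef h) h V.
Let Q h := box_diff (steklov_coef h) h Y.
Let m h := box_diff (steklov_coef h) h U.

(** [W] itself is not periodic: a shift by 1 adds a function of the second variable only, which the
    difference in the first variable cancels. *)
Let S1 h x c : S h (x + 1, c) = S h (x, c).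
Proof.
have V1 t y : V (t + 1, y) = V (t, y).
  by rewrite /V /=; congr integ; apply/funext => s; exact: U1.
have W1 t y : W (t + 1, y) = W (t, y) + integ (fun s => V (s, y)) 0 1.
  have cV : continuous (fun s => V (s, y)) by have cV := C1p_continuous HV; cts.
  have := integ_periodic t 1 cV (fun s => V1 s y); rewrite mul1r => <-.
  by rewrite /W /= integ_cat.
rewrite /S /box_diff /=.
have E t y : W (x + 1 + t, y) = W (x + t, y) + (fun y => integ (fun s => V (s, y)) 0 1) y.
  by rewrite (_ : x + 1 + t = x + t + 1); [exact: W1|ring].
move: (W) E; move: (fun y => integ (fun s => V (s, y)) 0 1) => w W' E.
congr (_ * _).
rewrite (E h (c + h)).
rewrite (E h (c + 0)).
rewrite (E 0 (c + h)).
rewrite (E 0 (c + 0)).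
have sub4 (a1 a2 a3 a4 w1 w2 : R) :
  (a1 + w1) - (a2 + w2) - ((a3 + w1) - (a4 + w2)) = a1 - a2 - (a3 - a4) by ring.
exact: sub4.
Qed.

(** By the mean value theorem in [c], the second difference of [U] is [h] times an increment of [Uy]
    over a step [h] in [x]. Monotonicity of [x + Uy] bounds that increment below by [- h]. *)
Let twist_ge h p : 0 < h -> h < 1 -> h <= 1 + m h p.
Proof.
case: p => x c h0 h1.
have [_ d2 _ _] := HU.
have [t _ E] := mean_value c (c + h) (fun t => is_deriveB (d2 (x + h) t) (d2 x t)).
have E' : U (x + h, c + h) - U (x + h, c) - (U (x, c + h) - U (x, c)) =
    (Uy (x + h, t) - Uy (x, t)) * h.
  have E2 : U (x + h, c + h) - U (x, c + h) - (U (x + h, c) - U (x, c)) =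
    (Uy (x + h, t) - Uy (x, t)) * (c + h - c) := E.
  have hE : c + h - c = h by ring.
  rewrite hE in E2; rewrite -E2.
  have perm4 (a1 a2 a3 a4 : R) : a1 - a2 - (a3 - a4) = a1 - a3 - (a2 - a4) by ring.
  exact: perm4.
rewrite /m /box_diff /= !addr0 E' /steklov_coef.
have mono : - h <= Uy (x + h, t) - Uy (x, t).
  by have := @U_mono x (x + h) t; rewrite lerDl ltW// => /(_ isT); lra.
move: (Uy (x + h, t) - Uy (x, t)) mono => a mono.
rewrite (_ : _ * _ * _ = a / h * (1 - h)); last first.
  by field; rewrite gt_eqF.
have : -1 <= a / h by rewrite ler_pdivlMr// mulN1r.
move: (_ / h) => z hz.
have : 0 <= (z + 1) * (1 - h) by apply: mulr_ge0; lra.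
by lra.
Qed.

(** Two applications of the mean value theorem: the average is a nearby value of [Ux], so
    convergence needs only the continuity of [Ux]. *)
Let P_mean h p : 0 < h -> exists q, [/\ `|q.1 - p.1| <= h, `|q.2 - p.2| <= h &
  P h p = (1 - h) * Ux q].
Proof.
case: p => x c h0; have [d1 _ _ _] := HU; have [_ v2 _ _] := HV.
have [t tc E] := mean_value c (c + h) (fun t => is_deriveB (v2 (x + h) t) (v2 x t)).
have {}E : V (x + h, c + h) - V (x, c + h) - (V (x + h, c) - V (x, c)) =
  (U (x + h, t) - U (x, t)) * (c + h - c) := E.
have [s sx E2] := mean_value x (x + h) (fun s => d1 s t).
have {}E2 : U (x + h, t) - U (x, t) = Ux (s, t) * (x + h - x) := E2.
have hE y : y + h - y = h by ring.
rewrite hE (gtr0_norm h0) in tc; rewrite hE (gtr0_norm h0) in sx.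
exists (s, t); split; [exact: sx|exact: tc|]; rewrite /P /box_diff /= !addr0 /steklov_coef.
rewrite E2 !hE in E.
have perm4 (a1 a2 a3 a4 : R) : a1 - a2 - (a3 - a4) = a1 - a3 - (a2 - a4) by ring.
rewrite perm4 E; move: (Ux _) => a.
by field; rewrite gt_eqF.
Qed.

Let Q_mean h p : 0 < h -> exists q, [/\ `|q.1 - p.1| <= h, `|q.2 - p.2| <= h &
  Q h p = (1 - h) * Uy q].
Proof.
case: p => x c h0; have [_ d2 _ _] := HU; have [y1 _ _ _] := HY.
have [s sx E] := mean_value x (x + h) (fun s => is_deriveB (y1 s (c + h)) (y1 s c)).
have {}E : Y (x + h, c + h) - Y (x + h, c) - (Y (x, c + h) - Y (x, c)) =
  (U (s, c + h) - U (s, c)) * (x + h - x) := E.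
have [t tc E2] := mean_value c (c + h) (fun t => d2 s t).
have {}E2 : U (s, c + h) - U (s, c) = Uy (s, t) * (c + h - c) := E2.
have hE y : y + h - y = h by ring.
rewrite hE (gtr0_norm h0) in tc; rewrite hE (gtr0_norm h0) in sx.
exists (s, t); split; [exact: sx|exact: tc|]; rewrite /Q /box_diff /= !addr0 /steklov_coef.
rewrite E2 !hE in E.
rewrite E; move: (Uy _) => a.
by field; rewrite gt_eqF.
Qed.

(** Continuous convergence: index and point move together, because the functions will be evaluated
    at points that depend on [n]. *)
Definition cts_cvg (Fn : nat -> R * R -> R) F := forall p0 e, 0 < e ->
  exists d N, 0 < d /\ forall n q, (N <= n)%N -> `|q.1 - p0.1| < d ->
    `|q.2 - p0.2| < d -> `|Fn n q - F p0| < e.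

(** The offset 2 makes every side strictly smaller than 1, as [twist_ge] requires. *)
Let hn (n : nat) : R := n.+2%:R^-1.

Lemma hn_itv n : 0 < hn n < 1.
Proof. by rewrite /hn invr_gt0 ltr0n/= invf_lt1 ?ltr0n// ltr1n. Qed.

Lemma hn_lt d : 0 < d -> exists N, forall n, (N <= n)%N -> hn n < d.
Proof.
move=> d0; exists (Num.Def.archi_bound d^-1) => n Nn.
rewrite /hn invf_plt ?posrE ?ltr0n//.
have := archi_boundP (ltW (_ : 0 < d^-1)); rewrite invr_gt0 => /(_ d0) lt.
by rewrite (lt_le_trans lt)// ler_nat (leq_trans Nn)// ltnW.
Qed.

Lemma cts_cvg_mean (Fn : nat -> R * R -> R) F : continuous F ->
  (forall n p, exists q, [/\ `|q.1 - p.1| <= hn n, `|q.2 - p.2| <= hn n &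
     Fn n p = (1 - hn n) * F q]) -> cts_cvg Fn F.
Proof.
move=> cF mean p0 e e0.
have /cvgrPdist_lt/(_ (e / 2)) := cF p0; rewrite divr_gt0// => /(_ isT).
move=> /nbhs_ballP[d /= d0 dF].
(* Nearby values of [F] are at most [|F p0| + e], so a side below [e] over this number keeps the
   damping error under [e / 2]. *)
have M0 : 0 < 2 * (`|F p0| + e) by rewrite mulr_gt0// ltr_wpDl.
have [N1 HN1] := hn_lt (divr_gt0 d0 (ltr0n R 2 : (0 < 2 :> R))).
have [N2 HN2] := hn_lt (divr_gt0 e0 M0).
exists (d / 2), (maxn N1 N2); split; first by rewrite divr_gt0.
move=> n p; rewrite geq_max => /andP[/HN1 h1 /HN2 h2] p1 p2.
have [q [q1 q2 ->]] := mean n p.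
have Fq : `|F p0 - F q| < e / 2.
  apply: dF; split; rewrite /ball /= distrC.
    rewrite (_ : q.1 - p0.1 = (q.1 - p.1) + (p.1 - p0.1)); last by ring.
    by rewrite (le_lt_trans (ler_normD _ _))// [d]splitr; lra.
  rewrite (_ : q.2 - p0.2 = (q.2 - p.2) + (p.2 - p0.2)); last by ring.
  by rewrite (le_lt_trans (ler_normD _ _))// [d]splitr; lra.
have /andP[hn0 hn1] := hn_itv n.
have Fq' : `|F q| <= `|F p0| + e.
  rewrite (_ : F q = F p0 - (F p0 - F q)); last by ring.
  by rewrite (le_trans (ler_normB _ _))// lerD2l; lra.
rewrite (_ : _ - _ = - (F p0 - F q) - hn n * F q); last by ring.
rewrite (le_lt_trans (ler_normB _ _))// normrN normrM (gtr0_norm hn0) [e]splitr ltr_leD//.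
rewrite ltr_pdivlMr// in h2.
have : hn n * `|F q| <= hn n * (`|F p0| + e) by rewrite ler_pM2l.
by lra.
Qed.

Lemma steklov_approximation : exists Sn Pn Qn : nat -> R * R -> R,
  [/\ forall n, exists Px m Qy d,
        [/\ C1p (Sn n) (Pn n) (Qn n), C1p (Pn n) Px m, C1p (Qn n) m Qy, 0 < d &
            forall p, d <= 1 + m p],
      forall n x c, Sn n (x + 1, c) = Sn n (x, c),
      cts_cvg Pn Ux & cts_cvg Qn Uy].
Proof.
exists (fun n => S (hn n)), (fun n => P (hn n)), (fun n => Q (hn n)); split.
- move=> n; have /andP[h0 h1] := hn_itv n.
  exists (box_diff (steklov_coef (hn n)) (hn n) (fun p => integ (fun t => Ux (p.1, t)) 0 p.2)).
  exists (m (hn n)).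
  exists (box_diff (steklov_coef (hn n)) (hn n) (fun p => integ (fun s => Uy (s, p.2)) 0 p.1)).
  exists (hn n); split; [exact: C1p_box_diff|exact: C1p_box_diff|exact: C1p_box_diff|by []|].
  by move=> p; exact: twist_ge.
- by move=> n x c; exact: S1.
- apply: cts_cvg_mean; first by case: HU.
  by move=> n p; apply: P_mean; case/andP: (hn_itv n).
- apply: cts_cvg_mean; first by case: HU.
  by move=> n p; apply: Q_mean; case/andP: (hn_itv n).
Qed.

End Steklov.

(** * Convergence of the generated diffeomorphisms *)

Section Straightening.
Variables (R : realType) (eta : R -> circle R -> R) (u : annulus R -> R).
Hypothesis eta_foliation : C0_foliation eta.
Hypothesis eta_integral : forall c : R, circle_integral (eta c) = c.
Hypothesis C1u : C1_annulus u.
Hypothesis eta_u : forall (theta : circle R) (c : R),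
  eta c theta = c + dtheta u (theta, c).
Hypothesis twist_u : forall c : R, homeomorphism
  (fun theta : circle R => theta + circ (dr u (theta, c))).

Let U p := u (covering p).

Let HU : C1p U (dx U) (dy U).
Proof. exact/C1_planeP. Qed.

Let U1 x c : U (x + 1, c) = U (x, c).
Proof. by rewrite /U /covering /= (circ_addz x 1). Qed.

Let etaE x c : eta c (circ x) = c + dx U (x, c).
Proof. by rewrite eta_u -[(circ x, c)]/(covering (x, c)) dtheta_covering. Qed.

Let dru x c : dr u (circ x, c) = dy U (x, c).
Proof. by []. Qed.

Let dru_cts : continuous (dr u).
Proof.
apply: cts_descend (@open_onto_covering R) _; case: HU => _ _ _.
by rewrite (_ : (fun _ => _) = dy U)//; apply/funext => -[x c]; exact: dru.
Qed.

Let dru_inj c : injective (fun th : circle R => th + circ (dr u (th, c))).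
Proof. by have [g [gK _ _ _]] := twist_u c; exact: can_inj gK. Qed.

(** The form in which the twist condition enters the Steklov averages. *)
Let U_mono x y c : x <= y -> x + dy U (x, c) <= y + dy U (y, c).
Proof.
rewrite le_eqVlt => /predU1P[->//|xy]; apply/ltW.
have [_ _ _ c2] := HU; have [_ D1] := C1p_periodic HU U1.
apply: (@circ_injective_increasing _ (fun x => x + dy U (x, c))) xy.
- by cts.
- by move=> t; rewrite D1; ring.
- by move=> s t; rewrite !circD -!dru => /dru_inj.
Qed.

Lemma homeomorphism_comp (X Y Z : topologicalType) (f : X -> Y) (g : Y -> Z) :
  homeomorphism f -> homeomorphism g -> homeomorphism (fun x => g (f x)).
Proof.
move=> [f' [fK f'K cf cf']] [g' [gK g'K cg cg']]; exists (fun z => f' (g' z)); split.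
- by move=> x; rewrite gK fK.
- by move=> z; rewrite f'K g'K.
- exact: (@cts_comp _ _ _ g f).
- exact: (@cts_comp _ _ _ f' g').
Qed.

Lemma straightening_of_generating_function : exact_symp_homeomorphic_to_standard eta.
Proof.
have [_ [A [fK AK cf cA]]] := eta_foliation.
(* [A] gives the foliation coordinates [(theta, c)] of a point and [B] twists each circle, so [B]
   after [A] sends the leaf [c] to the circle at height [c]. *)
pose B (p : annulus R) : annulus R := (p.1 + circ (dr u p), p.2).
have hB : homeomorphism B by exact: circle_bundle_homeomorphism dru_cts dru_inj.
have hA : homeomorphism A by exists (fun p => (p.1, eta p.2 p.1)).
pose Phi p := B (A p).
have hPhi : homeomorphism Phi := homeomorphism_comp hA hB.
have Phi_graph c th : Phi (th, eta c th) = (th + circ (dr u (th, c)), c).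
  by rewrite /Phi; have /= -> := fK (th, c).
have image c : Phi @` [set p | p.2 = eta c p.1] = [set p | p.2 = c].
  apply/seteqP; split=> [_ [[th r] /= -> <-]|q /= qc]; first by rewrite Phi_graph.
  have [Psi [_ PsiK _ _]] := hPhi; exists (Psi q); last exact: PsiK.
  have Ac : (A (Psi q)).2 = c by have := congr1 snd (PsiK q); rewrite qc.
  by have AKq := AK (Psi q); rewrite /= -AKq /= Ac.
exists Phi; last first.
  apply/seteqP; split=> [_ [_ [c _ <-] <-]|_ [c _ <-]].
    by exists c => //; rewrite image.
  exists [set p | p.2 = eta c p.1]; first by exists c.
  by rewrite image.
split; first exact: hPhi.
have [Sn [Pn [Qn [HSn Sn1 cvP cvQ]]]] := steklov_approximation HU U1 U_mono.
have diffeo n : exists g : annulus R -> annulus R, exists C,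
   [/\ exact_symplectic_diffeo g,
      forall x r, C (x, r) + Pn n (x, C (x, r)) = r,
      forall x c c', c <= c' -> c + Pn n (x, c) <= c' + Pn n (x, c') &
      forall x r, g (circ x, r) = (circ (x + Qn n (x, C (x, r))), C (x, r))].
  have [Px [m [Qy [d [H1 H2 H3 d0 dm]]]]] := HSn n.
  have [g [C [exg FC gE]]] := generated_exact_diffeo H1 H2 H3 d0 dm (Sn1 n).
  exists g, C; split => // x c c' cc'.
  have [_ p2 _ _] := H2.
  apply: (le_of_deriv_ge0 cc' (fun t => is_deriveD (is_derive_id t 1) (p2 x t))).
  by move=> t _; exact: le_trans (ltW d0) (dm _).
have [f fE] := choice diffeo.
exists f; first by move=> n; have [C []] := fE n.
pose c_ p := (A (covering p)).2.
have c_E p : eta (c_ p) (circ p.1) = p.2.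
  have := AK (covering p); rewrite /c_; case: (A _) => th c /= [-> ->] //.
have PhiE p : Phi (covering p) = (circ (p.1 + dy U (p.1, c_ p)), c_ p).
  have -> : covering p = (circ p.1, eta (c_ p) (circ p.1)) by rewrite c_E.
  rewrite Phi_graph.
  by rewrite circD dru.
(* The leaf parameter [C (x, r)] of the approximation is first trapped near [c_ p], using that
   [c + Pn n (x, c)] is nondecreasing in [c]. Continuous convergence of [Qn] then controls the
   angle. *)
have near_limit p e : 0 < e -> exists d N, 0 < d /\ forall n q, (N <= n)%N ->
    `|q.1 - p.1| < d -> `|q.2 - p.2| < d -> ball (Phi (covering p)) e (f n (covering q)).
  move=> e0; have [_ _ _ cdy] := HU.
  have [dQ [NQ [dQ0 HQ]]] := cvQ (p.1, c_ p) (e / 2) ltac:(by rewrite divr_gt0).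
  pose e1 := Num.min (Num.min dQ e) 1.
  have e10 : 0 < e1 by rewrite !lt_min dQ0 e0 ltr01.
  have e1dQ : e1 <= dQ by rewrite !ge_min lexx.
  have e1e : e1 <= e by rewrite !ge_min lexx orbT.
  (* The vertical gaps between [p] and the leaves [c_ p - e1 / 2] and [c_ p + e1 / 2]; half of each
     is spent on the error of [Pn], half on the displacement of [r]. *)
  pose lo := p.2 - eta (c_ p - e1 / 2) (circ p.1).
  pose hi := eta (c_ p + e1 / 2) (circ p.1) - p.2.
  have e120 : 0 < e1 / 2 by rewrite divr_gt0.
  have lo0 : 0 < lo.
    by rewrite subr_gt0 -(c_E p) (foliation_incr eta_foliation eta_integral)// gtrBl.
  have hi0 : 0 < hi.
    by rewrite subr_gt0 -(c_E p) (foliation_incr eta_foliation eta_integral)// ltrDl.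
  have lo20 : 0 < lo / 2 by rewrite divr_gt0.
  have hi20 : 0 < hi / 2 by rewrite divr_gt0.
  have [d1 [N1 [d10 H1]]] := cvP (p.1, c_ p - e1 / 2) (lo / 2) lo20.
  have [d2 [N2 [d20 H2]]] := cvP (p.1, c_ p + e1 / 2) (hi / 2) hi20.
  pose d := Num.min (Num.min (Num.min d1 d2) (Num.min dQ (e / 2))) (Num.min (lo / 2) (hi / 2)).
  have d0 : 0 < d by rewrite !lt_min d10 d20 dQ0 lo20 hi20 divr_gt0.
  exists d, (maxn NQ (maxn N1 N2)); split => // n [x r] /=.
  rewrite !geq_max => /and3P[nQ n1 n2]; rewrite !lt_min.
  move=> /andP[/andP[/andP[x1 x2] /andP[xQ xe]] _].
  move=> /andP[_ /andP[rl rh]].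
  have [C [_ FC Fm fnE]] := fE n.
  set c := C (x, r).
  have b1 := H1 n (x, c_ p - e1 / 2) n1 x1; rewrite /= subrr normr0 in b1.
  have b2 := H2 n (x, c_ p + e1 / 2) n2 x2; rewrite /= subrr normr0 in b2.
  have {}b1 := b1 d10; have {}b2 := b2 d20.
  have cl : c_ p - e1 / 2 < c.
    rewrite ltNge; apply/negP => /(Fm x); rewrite FC => h.
    move: b1 rl; rewrite /lo etaE !ltr_norml => /andP[? ?] /andP[? ?]; lra.
  have ch : c < c_ p + e1 / 2.
    rewrite ltNge; apply/negP => /(Fm x); rewrite FC => h.
    move: b2 rh; rewrite /hi etaE !ltr_norml => /andP[? ?] /andP[? ?]; lra.
  have cc : `|c - c_ p| < e1 by rewrite ltr_norml; lra.
  rewrite PhiE fnE -/c; split => /=.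
    exists (p.1 + dy U (p.1, c_ p)), (x + Qn n (x, c)); split => //.
    have := HQ n (x, c) nQ xQ (lt_le_trans cc e1dQ).
    rewrite distrC => hQ.
    rewrite (_ : _ - _ = - (x - p.1) + (dy U (p.1, c_ p) - Qn n (x, c))); last by ring.
    by rewrite (le_lt_trans (ler_normD _ _))// normrN [e]splitr ltrD.
  by rewrite /ball /= distrC (lt_le_trans cc).
move=> q0; have [p0 <-] := (open_onto_covering R).1 q0.
pose K : set (R * R) := `[p0.1 - 1, p0.1 + 1]%classic `*` `[p0.2 - 1, p0.2 + 1]%classic.
have nK : nbhs p0 K.
  apply/nbhs_ballP; exists 1 => //= q [q1 q2]; rewrite /ball /= in q1 q2.
  by split; rewrite /= in_itv/= -ler_distl distrC ltW.
exists (@covering R @` K); first exact: (open_onto_covering R).2.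
have cK : compact K by apply: compact_setX; exact: segment_compact.
apply/uniform_ballP => e e0.
suff : \forall n \near \oo, K `<=` (fun p => ball (Phi (covering p)) e (f n (covering p))).
  by apply: filterS => n Hn _ [p Kp <-]; exact: Hn.
apply: ((compact_near_coveringP _).1 cK) => p _.
have e20 : 0 < e / 2 by rewrite divr_gt0.
have [d [N [d0 HN]]] := near_limit p (e / 2) e20.
(* [near_limit] compares [f n] at [q] with [Phi] at [p]; continuity of [Phi] moves [p] to [q] for
   the other half of [e]. *)
have cPhi : continuous (fun p => Phi (covering p)).
  have [Psi [_ _ cP _]] := hPhi.
  exact: (@cts_comp _ _ _ Phi (@covering R) cP (@cts_covering R)).
have n1 : \forall q \near p, ball (Phi (covering p)) (e / 2) (Phi (covering q)).
  exact: (cPhi p _ (nbhsx_ballx _ _ e20)).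
have n2 : \forall q \near p, `|p.1 - q.1| < d /\ `|p.2 - q.2| < d.
  case: p {HN n1} => x c; near=> q; split; near: q; [exact: near_fst|exact: near_snd].
exists ([set q | ball (Phi (covering p)) (e / 2) (Phi (covering q)) /\
   (`|p.1 - q.1| < d /\ `|p.2 - q.2| < d)], [set n | (N <= n)%N]).
  by split => /=; [exact: filterI|exists N].
move=> [q n] /= [[b1 [q1 q2]] Nn].
rewrite [e]splitr; apply: ball_triangle (ball_sym b1) _.
by apply: HN => //; rewrite distrC.
Unshelve. all: by end_near. Qed.

End Straightening.

Theorem theorem1p5 (R : realType) (eta : R -> circle R -> R)
    (eta_foliation : C0_foliation eta)
    (eta_integral : forall c : R, circle_integral (eta c) = c) :
  exact_symp_homeomorphic_to_standard eta <->
  exists u : annulus R -> R,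
    [/\ C1_annulus u,
        forall r : R, u (0, r) = 0,
        forall (theta : circle R) (c : R),
          eta c theta = c + dtheta u (theta, c) &
        forall c : R, homeomorphism
          (fun theta : circle R => theta + circ (dr u (theta, c)))].
Proof.
split; first exact: generating_function_of_straightening.
by move=> [u [C1u _ eta_u twist_u]]; exact: straightening_of_generating_function twist_u.
Qed.
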